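(* Every convex $3$-dimensional simplicial complex is non-evasive.
   Context: Simplicial complexes are finite. A simplicial complex is convex if some geometric realization of it (linear embedding in some $\mathbb{R}^k$) is a convex subset of $\mathbb{R}^k$. Non-evasiveness is defined recursively: a $0$-dimensional simplicial complex is non-evasive if and only if it is a single point; a $d$-dimensional simplicial complex ($d>0$) is non-evasive if and only if it has some vertex $v$ such that the link of $v$ and the deletion of $v$ (the subcomplex of all faces not containing $v$) are both non-evasive. *)

(* Defs.v *)
From mathcomp Require Import all_boot all_order all_algebra.

Set Implicit Arguments.
Unset Strict Implicit.
Unset Printing Implicit Defensive.

Import Order.TTheory GRing.Theory Num.Theory.
Local Open Scope ring_scope.

Section Combinatorics.
Local Open Scope set_scope.
Variable T : finType.
Implicit Types (K : {set {set T}}) (v : T).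

(* A finite abstract simplicial complex with vertices in T. The empty set is
   always a face, and an element of T need not be a vertex of K. *)
Definition simplicial_complex K : Prop :=
  set0 \in K /\
  (forall s t : {set T}, s \in K -> t \subset s -> t \in K).

Definition vertices K : {set T} := [set v | [set v] \in K].

(* The complex [set set0] has dimension -1. *)
Definition complex_dim K : int := (\max_(s in K) #|s|)%:Z - 1.

Definition link K v : {set {set T}} :=
  [set s in K | (v \notin s) && (v |: s \in K)].

Definition deletion K v : {set {set T}} := [set s in K | v \notin s].

(* For a vertex v of K, both link K v and deletion K v have fewer vertices than
   K, so the recursion is well founded and its least fixed point is its only
   solution. *)
Inductive nonevasive : {set {set T}} -> Prop :=
| nonevasive_point K :
    complex_dim K = 0 -> #|vertices K| = 1%N -> nonevasive K
| nonevasive_step K v :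
    0 < complex_dim K -> v \in vertices K ->
    nonevasive (link K v) -> nonevasive (deletion K v) -> nonevasive K.

End Combinatorics.

From mathcomp Require Import all_classical all_reals convex.

Section Geometry.
Local Open Scope classical_set_scope.
Variables (R : realType) (T : finType) (k : nat).
Implicit Types (K : {set {set T}}) (f : T -> 'rV[R]_k).

(* The points of the polyhedron |K|, in barycentric coordinates. *)
Definition polyhedron K : set {ffun T -> R} :=
  [set w : {ffun T -> R} | [/\ forall x, 0 <= w x, \sum_x w x = 1
                             & [set x | w x != 0]%SET \in K]].

(* The map |K| -> R^k that is affine on every simplex and equals f on the
   vertices. *)
Definition linear_extension f (w : {ffun T -> R}) : 'rV[R]_k := \sum_x w x *: f x.

(* |K| is compact and linear_extension f is continuous, so injectivity on |K| makes
   it a topological embedding. *)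
Definition linear_embedding K f : Prop :=
  {in polyhedron K &, injective (linear_extension f)}.

Definition realization K f : set 'rV[R]_k := linear_extension f @` polyhedron K.

End Geometry.

Definition convex_complex (R : realType) (T : finType) (K : {set {set T}}) :
    Prop :=
  exists (k : nat) (f : T -> 'rV[R]_k),
    linear_embedding K f /\ convex_set (realization K f).

(* Main.v *)
(* Order the vertices of K by a generic linear functional and delete them from
   the top. It suffices that the link of each vertex v in the subcomplex of lower
   vertices, its descending link L, is non-evasive.

   L inherits its topology from a convex set: every point x of |K| near v and
   slightly below v lies in a face containing v, and the lower vertices of that
   face span a face supp x of L, which can only grow near x. Any locally constant
   datum on the faces of L therefore lives on a convex body, so L is connected
   and its first F_2-cohomology vanishes (double covers of convex sets are
   trivial).

   L is moreover embedded in a plane: each passage to a descending link keeps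
   the embedding and lowers the dimension by one. Hence the link of an extremal
   vertex of a subset of L is a forest, and there is such an extremal vertex w,
   in the subset or in a component left by a cut vertex, whose removal does not
   disconnect. By Mayer-Vietoris the link of w is connected, so it is a tree,
   and the deletion of w is again connected and acyclic. *)
Require Import Defs.
From mathcomp Require Import all_boot all_order all_algebra.
From mathcomp Require Import lra.
From mathcomp Require boolp classical_sets.
From mathcomp Require Import reals.
Set Implicit Arguments.
Unset Strict Implicit.
Unset Printing Implicit Defensive.
Import Order.TTheory GRing.Theory Num.Theory.
Local Open Scope ring_scope.

(** * Planar complexes, combinatorially *)

Section Combinatorics.
Local Open Scope set_scope.
Variable T : finType.
Implicit Types (K L : {set {set T}}) (A B : {set T}) (v w : T).

(** All subcomplexes met below are induced ones: links and deletions of [induced K A] are again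
    induced, so the recursion becomes an induction on the vertex set. *)
Definition induced K A : {set {set T}} := [set s in K | s \subset A].

Lemma in_induced K A s : (s \in induced K A) = (s \in K) && (s \subset A).
Proof. by rewrite inE. Qed.

Lemma in_vertices K v : (v \in vertices K) = ([set v] \in K).
Proof. by rewrite inE. Qed.

Lemma in_link K v s :
  (s \in link K v) = [&& s \in K, v \notin s & v |: s \in K].
Proof. by rewrite inE. Qed.

Lemma induced_complex K A :
  simplicial_complex K -> simplicial_complex (induced K A).
Proof.
case=> K0 Ks; split=> [|s t]; rewrite !in_induced ?K0 ?sub0set//.
by move=> /andP[sK sA] ts; rewrite (Ks s)//= (subset_trans ts).
Qed.

Lemma link_complex K v :
  simplicial_complex K -> [set v] \in K -> simplicial_complex (link K v).
Proof.
case=> K0 Ks vK; split=> [|s t]; rewrite !in_link ?K0 ?inE ?setU0//.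
move=> /and3P[sK vs vsK] ts; apply/and3P; split.
- exact: Ks sK ts.
- by apply: contraNN vs; apply/subsetP.
- by apply: Ks vsK _; rewrite setUS.
Qed.

Lemma link_vertex K v y : simplicial_complex K ->
  ([set y] \in link K v) = (v != y) && ([set v; y] \in K).
Proof.
move=> [K0 Ks]; rewrite in_link in_set1; apply/and3P/andP=> [[]|[]]//.
by move=> vy vyK; split=> //; apply: Ks vyK _; rewrite subsetUr.
Qed.

Lemma link_edge K v x y : simplicial_complex K ->
  ([set x; y] \in link K v) = [&& v != x, v != y & [set v; x; y] \in K].
Proof.
move=> [K0 Ks]; rewrite in_link !inE negb_or setUA -andbA.
apply/and4P/and3P=> [[]|[]]// vx vy vxyK; split=> //; apply: Ks vxyK _.
by rewrite -setUA subsetUr.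
Qed.

Lemma link_induced K A v :
  v \in A -> link (induced K A) v = induced (link K v) A.
Proof.
move=> vA; apply/setP=> s.
rewrite in_link !in_induced in_link subUset sub1set vA /=.
by do 2?case: (_ \in K); case: (s \subset A); case: (v \notin s).
Qed.

Lemma deletion_induced K A v : deletion (induced K A) v = induced K (A :\ v).
Proof. by apply/setP=> s; rewrite !inE subsetD1 andbA. Qed.

Lemma induced_link_D1 K A v : induced (link K v) (A :\ v) = induced (link K v) A.
Proof.
apply/setP=> s; rewrite !in_induced in_link subsetD1.
by case: (v \notin s); rewrite ?andbF ?andbT.
Qed.

Lemma eq_induced K A B : simplicial_complex K ->
  (forall x, [set x] \in K -> (x \in A) = (x \in B)) -> induced K A = induced K B.
Proof.
move=> [K0 Ks] AB; apply/setP=> s; rewrite !in_induced.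
case sK: (s \in K) => //=.
have sv x : x \in s -> [set x] \in K.
  by move=> xs; apply: Ks sK _; rewrite sub1set.
by apply/subsetP/subsetP=> h x xs; move: (h x xs); rewrite AB ?sv.
Qed.

Lemma complex_dim_gt0 K (s : {set T}) :
  s \in K -> (1 < #|s|)%N -> 0 < complex_dim K.
Proof.
move=> sK s1; rewrite /complex_dim subr_gt0 ltz_nat.
by apply: leq_trans s1 _; exact: (@leq_bigmax_cond _ _ (fun s : {set T} => #|s|)).
Qed.

Lemma nonevasive_vertex K : nonevasive K -> exists v, [set v] \in K.
Proof.
case=> [L _ /eqP/cards1P[v Lv]|L v _]; last by rewrite in_vertices; exists v.
by exists v; rewrite -in_vertices Lv set11.
Qed.

Lemma nonevasive_single K v :
  simplicial_complex K -> vertices K = [set v] -> nonevasive K.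
Proof.
move=> [K0 Ks] Kv.
have vK : [set v] \in K by rewrite -in_vertices Kv set11.
apply: nonevasive_point; last by rewrite Kv cards1.
rewrite /complex_dim; suff -> : \max_(s in K) #|s| = 1%N by [].
apply/eqP; rewrite eqn_leq; apply/andP; split; last first.
  by rewrite -[X in (X <= _)%N](cards1 v);
    exact: (@leq_bigmax_cond _ _ (fun s : {set T} => #|s|)).
apply/bigmax_leqP=> s sK; rewrite -(cards1 v) subset_leq_card// -Kv.
by apply/subsetP=> x xs; rewrite in_vertices (Ks s)// sub1set.
Qed.

Lemma nonevasive_induced1 K v :
  simplicial_complex K -> [set v] \in K -> nonevasive (induced K [set v]).
Proof.
move=> Kc vK; apply: (nonevasive_single (v := v)); first exact: induced_complex.
apply/setP=> x; rewrite in_vertices in_induced sub1set in_set1.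
by apply/andP/eqP => [[_ /eqP]|->].
Qed.

(** Positive dimension comes for free: a non-evasive link has a vertex [y], and [[set v; y]] is then
    an edge. *)
Lemma nonevasive_delete K A v :
  simplicial_complex K -> v \in A ->
  nonevasive (induced (link K v) A) -> nonevasive (induced K (A :\ v)) ->
  nonevasive (induced K A).
Proof.
move=> Kc vA nl nd; have [y] := nonevasive_vertex nl.
rewrite in_induced link_vertex// sub1set => /andP[/andP[vy vyK] yA].
apply: (nonevasive_step (v := v)).
- apply: (complex_dim_gt0 (s := [set v; y])); last by rewrite cards2 vy.
  by rewrite in_induced vyK subUset !sub1set vA.
- rewrite in_vertices in_induced sub1set vA andbT.
  by case: Kc => _; apply; [exact: vyK|exact: subsetUl].
- by rewrite link_induced.
- by rewrite deletion_induced.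
Qed.

(** * Deleting vertices from the top down *)

Section Order.
Variable R : realDomainType.
Implicit Types e g : T -> R.

Lemma exists_top A e : A != set0 -> {in A &, injective e} ->
  exists2 x, x \in A & {in A :\ x, forall y, e y < e x}.
Proof.
move=> /set0Pn[x0 x0A] ei.
have [x xA xm] : exists2 x, x \in A & {in A, forall y, e y <= e x}.
  by case: (Order.TotalTheory.arg_maxP e x0A) => x xA xm; exists x.
exists x => // y; rewrite in_setD1 => /andP[yx yA].
rewrite lt_neqAle xm// andbT; apply: contraNN yx => /eqP h.
by apply/eqP/ei.
Qed.

(** When the top vertex is deleted, its link in what remains is its descending link. The lowest
    vertex comes last, as a single point, so only vertices with some [y] below them need the
    hypothesis. *)
Lemma nonevasive_sweep K A e :
  simplicial_complex K -> {in A, forall x, [set x] \in K} ->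
  {in A &, injective e} -> A != set0 ->
  (forall x y, x \in A -> y \in A -> e y < e x ->
     nonevasive (induced (link K x) [set z in A | e z < e x])) ->
  nonevasive (induced K A).
Proof.
move=> Kc; have [n] := ubnP #|A|; elim: n A => // n IH A An AK ei A0 H.
have [x xA xm] := exists_top A0 ei.
have [Ax|[y yA]] := set_0Vmem (A :\ x).
  by rewrite -(setD1K xA) Ax setU0; apply: nonevasive_induced1 => //; exact: AK.
apply: (nonevasive_delete (v := x)) => //.
  rewrite -induced_link_D1 (_ : A :\ x = [set z in A | e z < e x]).
    by apply: (H x y) => //; [move: yA; rewrite in_setD1 => /andP[]|exact: xm].
  apply/setP=> z; rewrite !inE; have [->|zx] := eqVneq z x; first by rewrite ltxx andbF.
  by case zA: (z \in A) => //=; rewrite xm// in_setD1 zx.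
apply: IH.
- by move: An; rewrite (cardsD1 x A) xA.
- by move=> z; rewrite in_setD1 => /andP[_]; apply: AK.
- by move=> z t; rewrite !in_setD1 => /andP[_ zA] /andP[_ tA]; apply: ei.
- by apply/set0Pn; exists y.
move=> z t; rewrite !in_setD1 => /andP[zx zA] /andP[tx tA] tz.
(* Removing the top vertex [x] does not change which vertices lie below [z]. *)
rewrite (_ : [set _ in _ | _] = [set u in A | e u < e z]); first exact: (H z t).
apply/setP=> u; rewrite !inE; have [->|//] := eqVneq u x.
by rewrite /= xA/=; apply/esym/negbTE; rewrite -leNgt ltW// xm// in_setD1 zx.
Qed.

(** * Forests, connectivity and cohomology in degree 1 *)

(** At most one lower neighbour for each vertex. With [e] injective this excludes cycles, since the
    top vertex of a cycle would have two. *)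
Definition forest e L B := forall x y y', x \in B -> y \in B -> y' \in B ->
  e y < e x -> e y' < e x -> [set x; y] \in L -> [set x; y'] \in L -> y = y'.

Lemma forestS e L A B : B \subset A -> forest e L A -> forest e L B.
Proof.
move=> /subsetP BA H x y y' xB yB y'B; apply: H; exact: BA.
Qed.

(** Connectivity through locally constant functions, the form in which convexity delivers it. The
    empty graph counts as connected. *)
Definition graph_connected K A := forall f : T -> bool,
  {in A &, forall a b, [set a; b] \in K -> f a = f b} ->
  {in A &, forall a b, f a = f b}.

(* 1-cocycles over F_2; the degenerate triples make [c] symmetric on edges. *)
Definition cocycle1 K A (c : T -> T -> bool) :=
  {in A & &, forall a b d, [set a; b; d] \in K ->
     c a b (+) c b d (+) c a d = false}.

Definition acyclic1 K A := forall c, cocycle1 K A c ->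
  exists f : T -> bool,
    {in A &, forall a b, [set a; b] \in K -> c a b = f a (+) f b}.

(** The [e]-top vertex has a neighbour by connectivity and only one by the forest property. It is a
    leaf: its link is a point, and deleting it leaves a smaller tree. *)
Lemma nonevasive_tree L B e :
  simplicial_complex L -> {in B, forall x, [set x] \in L} ->
  {in B &, injective e} -> B != set0 -> graph_connected L B -> forest e L B ->
  nonevasive (induced L B).
Proof.
move=> Lc; have [n] := ubnP #|B|; elim: n B => // n IH B Bn BL ei B0 co fo.
have [x xB xm] := exists_top B0 ei.
have [Bx|[y0 y0B]] := set_0Vmem (B :\ x).
  by rewrite -(setD1K xB) Bx setU0; apply: nonevasive_induced1 => //; exact: BL.
(* Without a neighbour of [x], the indicator of [x] would be locally constant. *)
have [y yB xyL] : exists2 y, y \in B :\ x & [set x; y] \in L.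
  apply/exists_inP; apply: contraT; rewrite negb_exists_in => /forall_inP nxy.
  move: (y0B); rewrite in_setD1 => /andP[y0x y0A].
  suff : (x == x) = (y0 == x) by rewrite eqxx (negbTE y0x).
  apply: (co (fun z => z == x)) => // a b aB bB abL.
  have [ax|ax] := eqVneq a x; have [bx|bx] := eqVneq b x => //.
    by move: (nxy b); rewrite -ax abL in_setD1 ax bx bB => /(_ isT).
  by move: (nxy a); rewrite -bx setUC abL in_setD1 bx ax aB => /(_ isT).
move: (yB); rewrite in_setD1 => /andP[yx yA].
have uy z : z \in B :\ x -> [set x; z] \in L -> z = y.
  move=> zB xzL; apply: (fo x) => //; try exact: xm.
  by move: zB; rewrite in_setD1 => /andP[].
apply: (nonevasive_delete (v := x)) => //.
  apply: (nonevasive_single (v := y)).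
    by apply/induced_complex/link_complex => //; exact: BL.
  apply/setP=> z; rewrite in_vertices in_induced link_vertex// sub1set.
  rewrite in_set1; apply/andP/eqP=> [[/andP[xz xzL] zB]|->].
    by apply: uy => //; rewrite in_setD1 eq_sym xz.
  by rewrite eq_sym yx.
apply: IH.
- by move: Bn; rewrite (cardsD1 x B) xB.
- by move=> z; rewrite in_setD1 => /andP[_]; apply: BL.
- by move=> z t; rewrite !in_setD1 => /andP[_ zA] /andP[_ tA]; apply: ei.
- by apply/set0Pn; exists y.
- move=> f ff a b aB bB.
  (* A locally constant function extends to the leaf [x] by its value at [y]. *)
  have := co (fun z => if z == x then f y else f z) _ a b.
  move: (aB) (bB); rewrite !in_setD1.
  move=> /andP[/negbTE-> aB'] /andP[/negbTE-> bB']; apply=> //.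
  move=> u v uB vB uvL; have [ux|ux] := eqVneq u x; have [vx|vx] := eqVneq v x => //.
  + by rewrite (uy v)// -?ux// in_setD1 ux vx.
  + by rewrite (uy u)// -?vx// 1?setUC// in_setD1 vx ux.
  + by apply: ff => //; rewrite in_setD1 ?ux ?vx.
- by apply: forestS fo; exact: subD1set.
Qed.

(** Add the top vertex last: having at most one lower neighbour, its value has to satisfy at most
    one equation. *)
Lemma forest_coboundary L B e (c : T -> T -> bool) :
  {in B &, injective e} -> forest e L B ->
  {in B &, forall x y, [set x; y] \in L -> c x y = c y x} ->
  {in B, forall x, [set x] \in L -> c x x = false} ->
  exists f : T -> bool,
    {in B &, forall x y, [set x; y] \in L -> c x y = f x (+) f y}.
Proof.
have [n] := ubnP #|B|; elim: n B => // n IH B Bn ei fo cs c0.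
have [B0|Bn0] := eqVneq B set0; first by exists xpredT => x; rewrite B0 in_set0.
have [x xB xm] := exists_top Bn0 ei.
have sB z : z \in B :\ x -> z \in B by rewrite in_setD1 => /andP[].
have [f ff] : exists f : T -> bool,
    {in B :\ x &, forall a b, [set a; b] \in L -> c a b = f a (+) f b}.
  apply: IH.
  - by move: Bn; rewrite (cardsD1 x B) xB.
  - by move=> z t /sB zB /sB tB; apply: ei.
  - by apply: forestS fo; exact: subD1set.
  - by move=> a b /sB aB /sB bB; apply: cs.
  - by move=> a /sB aB; apply: c0.
have [k fk] : exists k : bool,
    forall y, y \in B :\ x -> [set x; y] \in L -> c x y = k (+) f y.
  have [/exists_inP[y yB xyL]|] := boolP [exists y in B :\ x, [set x; y] \in L].
    exists (c x y (+) f y) => z zB xzL.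
    suff -> : z = y by rewrite addbK.
    by apply: (fo x) => //; first [exact: sB | exact: xm].
  rewrite negb_exists_in => /forall_inP nxy; exists false => y yB xyL.
  by move: (nxy y yB); rewrite xyL.
exists (fun z => if z == x then k else f z) => a b aB bB abL.
have [ax|ax] := eqVneq a x; have [bx|bx] := eqVneq b x.
- by subst a b; rewrite addbb c0// -(setUid [set x]).
- by subst a; rewrite fk// in_setD1 bx.
- subst b; rewrite cs// fk 1?addbC// 1?in_setD1 ?ax//.
  by rewrite setUC.
- by apply: ff => //; rewrite in_setD1 ?ax ?bx.
Qed.

(** * Removable vertices of planar complexes *)

(** The only trace of planarity that the combinatorial argument uses. It passes to subsets of [A],
    and having both sides makes the lowest vertex available as well as the highest. *)
Definition extremal_forest K A g := forall w, w \in A ->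
  (exists e, let B := [set a in A | (g a < g w) && ([set w; a] \in K)] in
     {in B &, injective e} /\ forest e (link K w) B) /\
  (exists e, let B := [set a in A | (g w < g a) && ([set w; a] \in K)] in
     {in B &, injective e} /\ forest e (link K w) B).

Definition neighbours K A w := [set a in A :\ w | [set w; a] \in K].

Lemma in_neighbours K A w a :
  (a \in neighbours K A w) = [&& a != w, a \in A & [set w; a] \in K].
Proof. by rewrite !inE andbA. Qed.

(* If the extremal vertex found is a cut vertex, move to a component of its
   complement that avoids [r], with the cut vertex as new root. *)
Lemma exists_noncut_forest K A g r :
  {in A &, injective g} -> extremal_forest K A g ->
  graph_connected K A -> r \in A -> (1 < #|A|)%N ->
  exists w, [/\ w \in A, w != r, graph_connected K (A :\ w) &
    exists e, {in neighbours K A w &, injective e} /\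
              forest e (link K w) (neighbours K A w)].
Proof.
have [n] := ubnP #|A|; elim: n A r => // n IH A r An gi ex co rA A1.
have Ar : A :\ r != set0.
  by move: A1; rewrite (cardsD1 r A) rA ltnS card_gt0.
have [w [wA wr wex]] : exists w, [/\ w \in A, w != r &
    exists e, {in neighbours K A w &, injective e} /\
              forest e (link K w) (neighbours K A w)].
  have A0 : A != set0 by apply/set0Pn; exists r.
  have Ng : {in A &, injective (fun z => - g z)} by move=> x y xA yA /oppr_inj; apply: gi.
  have [x xA xm] := exists_top A0 gi.
  have [y yA ym] := exists_top A0 Ng.
  (* The top vertex serves unless it is the root. Then the bottom vertex does, and it differs from
     the top one because [A] has a further vertex. *)
  have [xr|xr] := eqVneq x r; last first.
    exists x; split=> //; have [[e [ei fe]] _] := ex x xA.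
    have S : neighbours K A x \subset [set a in A | (g a < g x) && ([set x; a] \in K)].
      apply/subsetP=> a; rewrite in_neighbours inE => /and3P[ax aA ->].
      by rewrite aA xm// in_setD1 ax.
    exists e; split; last exact: forestS S fe.
    by apply: sub_in2 ei; exact/subsetP.
  exists y; split=> //.
    apply/eqP=> yr; subst x y; move/set0Pn: Ar => [z zA].
    by move: (xm z zA) (ym z zA); rewrite ltrN2 => /lt_trans h /h; rewrite ltxx.
  have [_ [e [ei fe]]] := ex y yA.
  have S : neighbours K A y \subset [set a in A | (g y < g a) && ([set y; a] \in K)].
    apply/subsetP=> a; rewrite in_neighbours inE => /and3P[ay aA ->].
    by rewrite aA -ltrN2 ym// in_setD1 ay.
  exists e; split; last exact: forestS S fe.
  by apply: sub_in2 ei; exact/subsetP.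
have [cw|ncw] := boolp.pselect (graph_connected K (A :\ w)); first by exists w.
have [f ff [b bA fbr]] : exists2 f : T -> bool,
    {in A :\ w &, forall a b, [set a; b] \in K -> f a = f b} &
    exists2 b, b \in A :\ w & f b != f r.
  apply: boolp.contrapT => nf; apply: ncw => f ff.
  have fr z : z \in A :\ w -> f z = f r.
    by move=> zA; apply/eqP; apply: boolp.contrapT => /negP zr; apply: nf; exists f => //; exists z.
  by move=> a b aA bA; rewrite !fr.
(* A union of components of [A :\ w] that avoids [r]; it touches the rest of [A] only through
   [w]. *)
pose C := [set a in A :\ w | f a != f r].
have CA a : a \in C -> a \in A by rewrite !inE => /andP[/andP[]].
have rAw : r \in A :\ w by rewrite in_setD1 eq_sym wr.
have wC : w \notin C by rewrite !inE eqxx.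
have rC : r \notin C by rewrite !inE eqxx andbF.
have bC : b \in C by rewrite inE bA.
have nC a d : a \in C -> d \in A -> [set a; d] \in K -> d \in w |: C.
  move=> aC dA adK; rewrite in_setU1; have [//|dw] := eqVneq d w.
  move: aC; rewrite !inE dw dA /= => /andP[aA far].
  by rewrite -(ff a d) //; rewrite in_setD1 ?aA ?dw.
have sC : w |: C \subset A.
  by rewrite subUset sub1set wA; apply/subsetP.
(* Collapsing everything outside [C] to [w] extends locally constant functions from [w |: C] to [A].
   For [coD], it is [C] that is collapsed to [w]. *)
have coC : graph_connected K (w |: C).
  move=> h hh x y xC yC.
  have := co (fun z => if z \in C then h z else h w) _ x y.
  rewrite !(subsetP sC)// => /(_ _ isT isT).
  have hx z : z \in w |: C -> (if z \in C then h z else h w) = h z.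
    by rewrite in_setU1 => /orP[/eqP->|->//]; rewrite (negbTE wC).
  rewrite !hx//; apply=> u v uA vA uvK.
  have [uC|uC] := boolP (u \in C).
    have vC := nC _ _ uC vA uvK.
    by rewrite hx//; apply: hh => //; rewrite in_setU1 uC orbT.
  case: ifPn => // vC.
  have uC' : u \in w |: C by apply: (nC v) => //; rewrite setUC.
  move: uC'; rewrite in_setU1 (negbTE uC) orbF => /eqP uw; subst u.
  by apply: hh => //; rewrite in_setU1 ?eqxx// vC orbT.
have coD : graph_connected K (A :\: C).
  move=> h hh x y; rewrite !in_setD => /andP[xC xA] /andP[yC yA].
  have := co (fun z => if z \in C then h w else h z) _ x y xA yA.
  rewrite (negbTE xC) (negbTE yC); apply=> u v uA vA uvK.
  have wD : w \in A :\: C by rewrite in_setD wC.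
  have [uC|uC] := boolP (u \in C); have [vC|vC] := boolP (v \in C) => //.
  - have := nC u v uC vA uvK.
    by rewrite in_setU1 (negbTE vC) orbF => /eqP->.
  - have := nC v u vC uA; rewrite setUC => /(_ uvK).
    by rewrite in_setU1 (negbTE uC) orbF => /eqP->.
  - by apply: hh => //; rewrite in_setD ?uC ?vC.
have [w' [w'C w'w cw' [e [ei fe]]]] :
  exists w', [/\ w' \in w |: C, w' != w, graph_connected K ((w |: C) :\ w') &
    exists e, {in neighbours K (w |: C) w' &, injective e} /\
              forest e (link K w') (neighbours K (w |: C) w')].
  apply: IH.
  - rewrite -ltnS; apply: leq_trans An; rewrite ltnS; apply: proper_card.
    apply/properP; split=> //; exists r => //.
    by rewrite in_setU1 negb_or rC eq_sym wr.
  - by apply: sub_in2 gi; exact/subsetP.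
  - move=> x xC; have [[e1 [ei1 fe1]] [e2 [ei2 fe2]]] := ex x (subsetP sC x xC).
    split; [exists e1|exists e2].
      have S : [set a in w |: C | (g a < g x) && ([set x; a] \in K)] \subset
               [set a in A | (g a < g x) && ([set x; a] \in K)].
        by apply/subsetP=> a; rewrite inE => /andP[/(subsetP sC) aA h]; rewrite inE aA.
      split; last exact: forestS S fe1.
      by apply: sub_in2 ei1; exact/subsetP.
    have S : [set a in w |: C | (g x < g a) && ([set x; a] \in K)] \subset
             [set a in A | (g x < g a) && ([set x; a] \in K)].
      by apply/subsetP=> a; rewrite inE => /andP[/(subsetP sC) aA h]; rewrite inE aA.
    split; last exact: forestS S fe2.
    by apply: sub_in2 ei2; exact/subsetP.
  - exact: coC.
  - exact: setU11.
  - by rewrite cardsU1 wC add1n ltnS card_gt0; apply/set0Pn; exists b.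
have w'CC : w' \in C by move: w'C; rewrite in_setU1 (negbTE w'w).
have w'A : w' \in A := CA _ w'CC.
(* As [w'] lies in [C], no neighbour of it is lost in [w |: C], so the forest found there serves in
   [A]. *)
have NN : neighbours K A w' \subset neighbours K (w |: C) w'.
  apply/subsetP=> a; rewrite !in_neighbours => /and3P[-> aA waK].
  by rewrite waK andbT; exact: nC waK.
exists w'; split=> //.
- by apply: contraNneq rC => <-.
- move=> h hh.
  (* The connected pieces [(w |: C) :\ w'] and [A :\: C] cover [A :\ w'] and share [w]. *)
  have hw x : x \in A :\ w' -> h x = h w.
    rewrite in_setD1 => /andP[xw' xA].
    have [xC|xC] := boolP (x \in C).
      apply: (cw' h); rewrite ?in_setD1 ?xw' ?in_setU1 ?xC ?orbT//.
      - move=> u v; rewrite !in_setD1 => /andP[uw' uC] /andP[vw' vC].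
        by apply: hh; rewrite in_setD1 ?uw' ?vw' (subsetP sC).
      - by rewrite eqxx eq_sym w'w.
    apply: (coD h); rewrite ?in_setD ?xC ?xA ?wC ?wA//.
    move=> u v; rewrite !in_setD => /andP[uC uA] /andP[vC vA].
    apply: hh; rewrite in_setD1 ?uA ?vA andbT.
      by apply: contraNneq uC => ->.
    by apply: contraNneq vC => ->.
  by move=> x y xA yA; rewrite !hw.
- exists e; split; last exact: forestS NN fe.
  by apply: sub_in2 ei; exact/subsetP.
Qed.

(** * Mayer-Vietoris at a vertex *)

(** Extends [c] from the deletion of [w] by [g] on the edges at [w]. On a triangle at [w] the
    cocycle condition says that [g] is a primitive of [c] along the opposite edge. *)
Definition cone_cochain w (g : T -> bool) (c : T -> T -> bool) a b :=
  if a == w then if b == w then false else g b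
  else if b == w then g a else c a b.

Lemma cone_cocycle K A w (g : T -> bool) c : simplicial_complex K ->
  cocycle1 K (A :\ w) c ->
  {in neighbours K A w &, forall x y, [set x; y] \in link K w ->
     c x y = g x (+) g y} ->
  cocycle1 K A (cone_cochain w g c).
Proof.
move=> Kc cc cg a b d aA bA dA abdK; have [_ Ks] := Kc.
have E x y : x \in A -> y \in A -> x != w -> y != w -> [set w; x; y] \in K ->
    c x y = g x (+) g y.
  move=> xA yA xw yw wxy; apply: cg.
  - by rewrite in_neighbours xw xA; apply: Ks wxy _; exact: subsetUl.
  - rewrite in_neighbours yw yA; apply: Ks wxy _.
    by rewrite !subUset !sub1set !inE !eqxx !orbT.
  - by rewrite link_edge// ![w == _]eq_sym xw yw.
have P x y z : x \in [set a; b; d] -> y \in [set a; b; d] -> z \in [set a; b; d] ->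
    [set x; y; z] \in K.
  by move=> xs ys zs; apply: Ks abdK _; rewrite !subUset !sub1set xs ys.
rewrite /cone_cochain.
have [aw|aw] := eqVneq a w; have [bw|bw] := eqVneq b w;
  have [dw|dw] := eqVneq d w; subst; rewrite ?addbb ?addFb ?addbF ?addbb //.
- by rewrite (E b d)//; case: (g b); case: (g d).
- rewrite (E a d)//; first by case: (g a); case: (g d).
  by apply: P; rewrite !inE eqxx ?orbT.
- rewrite (E a b)//; first by case: (g a); case: (g b).
  by apply: P; rewrite !inE eqxx ?orbT.
- by apply: cc; rewrite // in_setD1 ?aw ?bw ?dw.
Qed.

(* The indicator of a component of the link, placed on the edges at [w], is a
   cocycle, and a primitive of it is constant off [w]. *)
Lemma link_graph_connected K A w : simplicial_complex K ->
  acyclic1 K A -> w \in A -> graph_connected K (A :\ w) ->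
  graph_connected (link K w) (neighbours K A w).
Proof.
move=> Kc acy wA co h hh.
have [|f ff] := acy (cone_cochain w h (fun _ _ => false)).
  apply: cone_cocycle => // x y xN yN xyL; rewrite (hh x y)//.
  by rewrite addbb.
move=> x y; rewrite !in_neighbours => /and3P[xw xA wxK] /and3P[yw yA wyK].
have fxy : f x = f y.
  apply: (co f); rewrite ?in_setD1 ?xw ?yw//.
  move=> u v; rewrite !in_setD1 => /andP[uw uA] /andP[vw vA] uvK.
  have := ff u v uA vA uvK; rewrite /cone_cochain (negbTE uw) (negbTE vw).
  by case: (f u); case: (f v).
have := ff w x wA xA wxK; have := ff w y wA yA wyK.
rewrite /cone_cochain eqxx (negbTE xw) (negbTE yw) fxy.
by move=> -> ->.
Qed.

(** A cocycle off [w] has a primitive on the link, which is a forest, and so extends over [w]. A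
    primitive of the extension restricts to one of the cocycle. *)
Lemma acyclic1_delete K A w e : simplicial_complex K ->
  acyclic1 K A -> w \in A ->
  {in neighbours K A w &, injective e} ->
  forest e (link K w) (neighbours K A w) -> acyclic1 K (A :\ w).
Proof.
move=> Kc acy wA ei fe c cc; have [_ Ks] := Kc.
have NA x : x \in neighbours K A w -> x \in A :\ w.
  by rewrite in_neighbours in_setD1 => /and3P[-> ->].
have c0 a : a \in A :\ w -> [set a] \in K -> c a a = false.
  move=> aA aK; have := cc a a a aA aA aA; rewrite !setUid => /(_ aK).
  by case: (c a a).
have cs a b : a \in A :\ w -> b \in A :\ w -> [set a; b] \in K -> c a b = c b a.
  move=> aA bA abK; have aK : [set a] \in K.
    by apply: Ks abK _; exact: subsetUl.
  have := cc a b a aA bA aA; rewrite -setUA [X in _ :|: X]setUC setUA.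
  by rewrite setUid c0// => /(_ abK); case: (c a b); case: (c b a).
have [g gg] : exists g : T -> bool, {in neighbours K A w &, forall x y,
    [set x; y] \in link K w -> c x y = g x (+) g y}.
  apply: forest_coboundary ei fe _ _.
    by move=> x y /NA xA /NA yA; rewrite in_link => /andP[xyK _]; exact: cs.
  by move=> x /NA xA; rewrite in_link => /andP[xK _]; exact: c0.
have [f ff] := acy _ (cone_cocycle Kc cc gg).
exists f => a b; rewrite !in_setD1 => /andP[aw aA] /andP[bw bA] abK.
by rewrite -ff// /cone_cochain (negbTE aw) (negbTE bw).
Qed.

(** A non-cut vertex [w] whose link is a forest has a connected link, hence a tree. All hypotheses
    survive the deletion of [w]. *)
Lemma nonevasive_planar K A g :
  simplicial_complex K -> {in A, forall x, [set x] \in K} ->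
  {in A &, injective g} -> A != set0 ->
  graph_connected K A -> acyclic1 K A -> extremal_forest K A g ->
  nonevasive (induced K A).
Proof.
move=> Kc; have [n] := ubnP #|A|; elim: n A => // n IH A An AK gi A0 co acy ex.
have [r rA] := set0Pn _ A0.
have [A1|] := ltnP 1 #|A|; last first.
  rewrite leq_eqVlt ltnS leqn0 cards_eq0 (negbTE A0) orbF => /cards1P[x Ax].
  by rewrite Ax; apply: nonevasive_induced1 => //; apply: AK; rewrite Ax set11.
have [w [wA wr cow [e [ei fe]]]] := exists_noncut_forest gi ex co rA A1.
apply: (nonevasive_delete (v := w)) => //.
  have Lc : simplicial_complex (link K w) by apply: link_complex => //; exact: AK.
  rewrite (_ : induced _ A = induced (link K w) (neighbours K A w)).
    apply: nonevasive_tree ei _ _ fe => //.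
    - move=> x; rewrite link_vertex// in_neighbours => /and3P[xw _ ->].
      by rewrite eq_sym xw.
    (* An isolated [w] would contradict connectivity through its indicator. *)
    - apply/negP=> /eqP N0; suff : (w == w) = (r == w) by rewrite eqxx eq_sym (negbTE wr).
      apply: (co (fun z => z == w)) => // a b aA bA abK.
      have [aw|aw] := eqVneq a w; have [bw|bw] := eqVneq b w => //; subst.
        by have := in_set0 b; rewrite -N0 in_neighbours bw bA abK.
      by have := in_set0 a; rewrite -N0 in_neighbours aw aA setUC abK.
    - exact: link_graph_connected.
  apply: eq_induced => // x; rewrite link_vertex// in_neighbours eq_sym => /andP[-> ->].
  by rewrite andbT.
have sA : {subset A :\ w <= A} by apply/subsetP; exact: subD1set.
apply: IH.
- by move: An; rewrite (cardsD1 w A) wA.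
- by move=> x /sA; apply: AK.
- exact: sub_in2 gi.
- by apply/set0Pn; exists r; rewrite in_setD1 eq_sym wr.
- exact: cow.
- exact: acyclic1_delete ei fe.
- move=> x /sA xA; have [[e1 [ei1 fe1]] [e2 [ei2 fe2]]] := ex x xA.
  split; [exists e1|exists e2].
    have S : [set a in A :\ w | (g a < g x) && ([set x; a] \in K)] \subset
             [set a in A | (g a < g x) && ([set x; a] \in K)].
      by apply/subsetP=> a; rewrite inE => /andP[/sA aA h]; rewrite inE aA.
    split; last exact: forestS S fe1.
    by apply: sub_in2 ei1; exact/subsetP.
  have S : [set a in A :\ w | (g x < g a) && ([set x; a] \in K)] \subset
           [set a in A | (g x < g a) && ([set x; a] \in K)].
    by apply/subsetP=> a; rewrite inE => /andP[/sA aA h]; rewrite inE aA.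
  split; last exact: forestS S fe2.
  by apply: sub_in2 ei2; exact/subsetP.
Qed.

End Order.
End Combinatorics.

(** * Linear embeddings of links *)

Section Linear.
Local Open Scope set_scope.
Variables (R : realType) (T : finType) (k : nat).
Implicit Types (K L : {set {set T}}) (A B : {set T}) (f p : T -> 'rV[R]_k).
Implicit Types (w : T -> R) (u : 'cV[R]_k).

(** The points of [polyhedron K] as plain functions compared pointwise, so that weights can be given
    by formulas. *)
Definition weight K w : Prop :=
  [/\ forall x, 0 <= w x, \sum_x w x = 1 & [set x | w x != 0] \in K].

Definition embedding K f : Prop := forall w w', weight K w -> weight K w' ->
  \sum_x w x *: f x = \sum_x w' x *: f x -> w =1 w'.

Lemma linear_embeddingW K f : linear_embedding K f -> embedding K f.
Proof.
move=> inj w w' [w0 w1 wK] [w0' w1' wK'] ww' x.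
have P (z : T -> R) : weight K z -> polyhedron K (finfun z).
  move=> [z0 z1 zK]; split=> [y||].
  - by rewrite ffunE.
  - by rewrite -z1; apply: eq_bigr => y _; rewrite ffunE.
  - by rewrite -[X in X \in K](_ : [set y | z y != 0] = _)//; apply/setP=> y; rewrite !inE ffunE.
have E (z : T -> R) : linear_extension f (finfun z) = \sum_y z y *: f y.
  by apply: eq_bigr => y _; rewrite ffunE.
have M (z : T -> R) (zK : weight K z) := classical_sets.mem_set (P z zK).
have /ffunP/(_ x) : finfun w = finfun w'.
  by apply: inj; [exact/M|exact/M|rewrite !E].
by rewrite !ffunE.
Qed.

Definition mass w := (forall a, 0 <= w a) /\ \sum_a w a = 1.

Lemma mass_delta a : mass (fun x => (x == a)%:R).
Proof.
split=> [x|]; first exact: ler0n.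
by rewrite (bigD1 a)//= eqxx big1 ?addr0// => i /negbTE->.
Qed.

Lemma weight_delta K a : [set a] \in K -> weight K (fun x => (x == a)%:R).
Proof.
move=> aK; have [d0 d1] := mass_delta a; split=> //.
rewrite (_ : [set x | _] = [set a])//; apply/setP=> x.
by rewrite !inE pnatr_eq0 eqb0 negbK.
Qed.

Lemma sum_delta (a : T) f : \sum_x (x == a)%:R *: f x = f a.
Proof.
by rewrite (bigD1 a)//= eqxx scale1r big1 ?addr0// => i /negbTE->; rewrite scale0r.
Qed.

Lemma embedding_inj K f a b : embedding K f ->
  [set a] \in K -> [set b] \in K -> f a = f b -> a = b.
Proof.
move=> inj aK bK fab.
have := inj _ _ (weight_delta aK) (weight_delta bK).
rewrite !sum_delta => /(_ fab a); rewrite eqxx.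
by case: eqP => // _ /eqP; rewrite oner_eq0.
Qed.

(* A point of the link at small distance from [v]: scale the weights down and
   put the remaining mass at [v]. *)
Lemma embedding_link K A f v (l : T -> R) :
  embedding K f -> {in A, forall a, 0 < l a} ->
  embedding (induced (link K v) A) (fun a => l a *: (f a - f v)).
Proof.
move=> inj lp w w' ww ww' E.
have P (z : T -> R) : weight (induced (link K v) A) z ->
    [/\ z v = 0, forall a, 0 <= z a * l a,
       forall a, a \notin A -> z a = 0 & v |: [set x | z x != 0] \in K].
  move=> [z0 z1]; rewrite in_induced in_link inE negbK => /andP[/and3P[_ /eqP zv zK] zA].
  have zA0 a : a \notin A -> z a = 0.
    by apply: contraNeq => za; apply: (subsetP zA); rewrite inE.
  split=> // a; have [aA|/zA0->] := boolP (a \in A); last by rewrite mul0r.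
  by rewrite mulr_ge0// ltW// lp.
pose S z := \sum_x z x * l x.
have S0 z : weight (induced (link K v) A) z -> 0 <= S z.
  by move=> zw; have [_ h _ _] := P z zw; apply: sumr_ge0 => x _.
(* A common scale for [w] and [w']: [s * S z < 1] keeps positive mass at [v], so the support of
   [W z] is that of [z] together with [v]. *)
pose s := (1 + S w + S w')^-1.
have Sp : 0 < 1 + S w + S w' by have := S0 _ ww; have := S0 _ ww'; lra.
have s0 : 0 < s by rewrite invr_gt0.
pose W (z : T -> R) x := (x == v)%:R * (1 - s * S z) + s * (z x * l x).
have WP z : weight (induced (link K v) A) z -> S z <= S w + S w' ->
    weight K (W z).
  move=> zw zS; have [h0 h1 h2 h3] := P z zw.
  have sS : s * S z < 1.
    by rewrite mulrC ltr_pdivrMr//; lra.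
  split.
  - by move=> x; rewrite /W addr_ge0// mulr_ge0// ?ler0n// ?subr_ge0 ltW.
  - rewrite /W big_split/= -mulr_suml -mulr_sumr -/(S z).
    rewrite (bigD1 v)//= eqxx big1 ?addr0; last by move=> i /negbTE->.
    by rewrite mul1r subrK.
  - suff -> : [set x | W z x != 0] = v |: [set x | z x != 0] by [].
    apply/setP=> x; rewrite !inE /W; have [->|xv] := eqVneq x v.
      by rewrite h0 mul0r mulr0 mul1r addr0 subr_eq0; apply/eqP=> h; move: sS; rewrite -h ltxx.
    rewrite mul0r add0r !mulf_eq0 (gt_eqF s0) /=.
    have [xA|xA] := boolP (x \in A); first by rewrite (gt_eqF (lp x xA)) orbF.
    by rewrite h2// eqxx.
have WE z : \sum_x W z x *: f x = f v + s *: (\sum_x z x *: (l x *: (f x - f v))).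
  transitivity (\sum_x ((x == v)%:R *: ((1 - s * S z) *: f x)) +
                 s *: \sum_x (z x * l x) *: f x).
    rewrite scaler_sumr -big_split/=; apply: eq_bigr => x _.
    by rewrite /W scalerDl !scalerA.
  rewrite (sum_delta v (fun x => (1 - s * S z) *: f x)).
  under [in RHS]eq_bigr do rewrite scalerA scalerBr.
  rewrite [in RHS]sumrB -scaler_suml -/(S z) scalerBl scale1r scalerBr scalerA.
  by rewrite -!addrA; congr (_ + _); rewrite addrC.
move=> x.
have WW : W w =1 W w'.
  apply: inj.
  - by apply: WP => //; have := S0 _ ww'; lra.
  - by apply: WP => //; have := S0 _ ww; lra.
  - by rewrite !WE E.
have [a0 a1 a2 a3] := P w ww; have [b0 b1 b2 b3] := P w' ww'.
have [->|xv] := eqVneq x v; first by rewrite a0 b0.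
have [xA|xA] := boolP (x \in A); last by rewrite a2 ?b2.
have := WW x; rewrite /W (negbTE xv) !mul0r !add0r.
by move=> /(mulfI (lt0r_neq0 s0)) /(mulIf (lt0r_neq0 (lp x xA))).
Qed.

(** * Generic functionals, affine dimension and projection from a vertex *)

Definition functional u (x : 'rV[R]_k) : R := (x *m u) 0 0.

Lemma functionalB u x y : functional u (x - y) = functional u x - functional u y.
Proof. by rewrite /functional mulmxBl !mxE. Qed.

Lemma functionalZ u a x : functional u (a *: x) = a * functional u x.
Proof. by rewrite /functional -scalemxAl mxE. Qed.

Lemma functional_sum u (w : T -> R) f :
  functional u (\sum_x w x *: f x) = \sum_x w x * functional u (f x).
Proof.
rewrite /functional mulmx_suml summxE; apply: eq_bigr => x _.
by rewrite -scalemxAl mxE.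
Qed.

Lemma functionalN u x : functional (- u) x = - functional u x.
Proof. by rewrite /functional mulmxN mxE. Qed.

Lemma exists_nonroot (q : {poly R}) : q != 0 -> exists t, ~~ root q t.
Proof.
move=> q0; have [/allP h|/allPn[t _ tq]] :=
  boolP (all (root q) [seq i%:R | i <- iota 0 (size q)]); last by exists t.
have /(max_poly_roots q0) : all (root q) [seq i%:R | i <- iota 0 (size q)].
  exact/allP.
rewrite map_inj_uniq ?iota_uniq => [/(_ isT)|i j /eqP]; last by rewrite eqr_nat => /eqP.
by rewrite size_map size_iota ltnn.
Qed.

(* The functionals (1, t, t^2, ...): only finitely many [t] are bad. *)
Lemma generic_functional f :
  exists u, forall a b, f a != f b -> functional u (f a) != functional u (f b).
Proof.
pose q (d : 'rV[R]_k) := \sum_(i < k) d 0 i *: 'X^i.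
have q0 d : d != 0 -> q d != 0.
  apply: contra_neq => qd; apply/rowP=> i; rewrite mxE.
  have := congr1 (fun r : {poly R} => r`_i) qd; rewrite coef0 coef_sum (bigD1 i)//=.
  rewrite coefZ coefXn eqxx mulr1 big1 ?addr0// => j ji.
  by rewrite coefZ coefXn eq_sym (inj_eq val_inj) (negbTE ji) mulr0.
have [t tP] : exists t, ~~ root (\prod_(ab : T * T | f ab.1 != f ab.2)
    q (f ab.1 - f ab.2)) t.
  apply: exists_nonroot; apply/prodf_neq0 => -[a b] /= ab.
  by apply: q0; rewrite subr_eq0.
exists (\col_i t ^+ i) => a b ab; rewrite -subr_eq0 -functionalB.
have -> : functional (\col_i t ^+ i) (f a - f b) = (q (f a - f b)).[t].
  rewrite /functional mxE horner_sum; apply: eq_bigr => i _.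
  by rewrite hornerZ hornerXn [X in _ * X]mxE.
by apply: contraNneq tP => h; rewrite (bigD1 (a, b))//= rootM /root h eqxx.
Qed.

(** Bounds the dimension of the affine span of the points [f a]. Using differences avoids a base
    point. *)
Definition dim_le n A f := exists2 V : 'M[R]_k, (\rank V <= n)%N &
  {in A &, forall a b, (f a - f b <= V)%MS}.

Lemma dim_leS n A B f : B \subset A -> dim_le n A f -> dim_le n B f.
Proof. by move=> /subsetP BA [V Vn AV]; exists V => //; exact: sub_in2 AV. Qed.

Lemma dim_le0 A f : dim_le 0 A f -> {in A &, forall a b, f a = f b}.
Proof.
move=> [V]; rewrite leqn0 mxrank_eq0 => /eqP-> h a b aA bA.
by apply/eqP; rewrite -subr_eq0 -submx0; exact: h.
Qed.

(** Central projection from [f v] to the hyperplane one unit below it, with [f v] as origin. *)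
Definition slope u f v a :=
  (functional u (f v) - functional u (f a))^-1 *: (f a - f v).

(** All slopes have [u]-value -1, so their differences lie in [V :&: kermx u]. This is smaller than
    [V] once [A] has a vertex [a], as [u] does not vanish on [f a - f v]. *)
Lemma dim_le_link n A f v u : dim_le n.+1 (v |: A) f ->
  {in A, forall a, functional u (f a) < functional u (f v)} ->
  dim_le n A (slope u f v).
Proof.
move=> [V Vn VA] hA; have [->|[a aA]] := set_0Vmem A.
  by exists 0; [rewrite mxrank0|move=> a b; rewrite in_set0].
have aV b : b \in A -> (f b - f v <= V)%MS.
  by move=> bA; rewrite VA ?setU11// in_setU1 bA orbT.
exists (V :&: kermx u)%MS.
  have := mxrank_leqif_sup (capmxSl V (kermx u)).
  rewrite sub_capmx submx_refl /= => -[le1 e1].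
  rewrite -ltnS; apply: leq_trans Vn; rewrite ltn_neqAle le1 andbT e1.
  apply/negP=> Vu; have /sub_kermxP h := submx_trans (aV a aA) Vu.
  by have := hA a aA; rewrite -subr_lt0 -functionalB /functional h mxE ltxx.
have su b : b \in A -> functional u (slope u f v b) = -1.
  move=> bA; have h := hA b bA; rewrite functionalZ functionalB.
  by rewrite -[X in _ * X]opprB mulrN mulVf// subr_eq0 gt_eqF.
move=> b d bA dA; rewrite sub_capmx addmx_sub ?eqmx_opp ?scalemx_sub ?aV//=.
apply/sub_kermxP/matrixP=> i j; rewrite !ord1 [RHS]mxE.
by rewrite -/(functional u _) functionalB !su// subrr.
Qed.

Lemma embedding_slope K A f v u : embedding K f ->
  {in A, forall a, functional u (f a) < functional u (f v)} ->
  embedding (induced (link K v) A) (slope u f v).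
Proof.
move=> inj hA; apply: embedding_link => // a aA.
by rewrite invr_gt0 subr_gt0 hA.
Qed.

(** Projection from [f w] puts the lower part of the link of [w] in a line, ordered by a generic
    functional. Projection from a vertex [x] of that part puts the lower neighbours of [x] in one
    point, so an embedding allows only one of them. *)
Lemma slope_forest L A f u (w : T) : simplicial_complex L ->
  embedding L f -> {in A, forall x, [set x] \in L} -> dim_le 2 A f -> w \in A ->
  exists e : T -> R,
   let B := [set a in A | (functional u (f a) < functional u (f w)) &&
                          ([set w; a] \in L)] in
   {in B &, injective e} /\ forest e (link L w) B.
Proof.
move=> Lc inj AL dA wA.
set B := [set a in A | _].
have BP a : a \in B ->
    [/\ a \in A, functional u (f a) < functional u (f w) & [set w; a] \in L].
  by rewrite inE => /and3P[].
have Bw a : a \in B -> w != a.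
  by move=> /BP[_ + _]; apply: contraTneq => ->; rewrite ltxx.
pose L2 := induced (link L w) B.
have L2c : simplicial_complex L2 by apply/induced_complex/link_complex => //; exact: AL.
have L2B a : a \in B -> [set a] \in L2.
  by move=> aB; rewrite in_induced link_vertex// sub1set aB Bw//=; have [_ _ ->] := BP a aB.
have inj2 : embedding L2 (slope u f w).
  by apply: embedding_slope => // a /BP[].
have d2 : dim_le 1 B (slope u f w).
  apply: dim_le_link; last by move=> a /BP[].
  apply: dim_leS dA; rewrite subUset sub1set wA; apply/subsetP=> a.
  by move=> /BP[].
have [u2 u2P] := generic_functional (slope u f w).
exists (fun a => functional u2 (slope u f w a)); split.
  move=> a b aB bB /eqP h; apply: (embedding_inj inj2); rewrite ?L2B//.
  by apply/eqP; apply: contraTT h; exact: u2P.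
move=> x y y' xB yB y'B yx y'x xyL xy'L.
pose C := [set y; y'].
have CP a : a \in C -> [/\ a \in B, functional u2 (slope u f w a) <
   functional u2 (slope u f w x) & [set x; a] \in link L w].
  by rewrite in_set2 => /orP[/eqP->|/eqP->].
have inj3 : embedding (induced (link L2 x) C) (slope u2 (slope u f w) x).
  by apply: embedding_slope => // a /CP[].
have d3 : dim_le 0 C (slope u2 (slope u f w) x).
  apply: dim_le_link; last by move=> a /CP[].
  apply: dim_leS d2; rewrite subUset sub1set xB; apply/subsetP=> a.
  by move=> /CP[].
have L3 a : a \in C -> [set a] \in induced (link L2 x) C.
  move=> aC; have [aB ax axL] := CP a aC.
  rewrite in_induced sub1set aC link_vertex// in_induced axL andbT.
  rewrite subUset !sub1set xB aB /= andbT.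
  by apply: contraTneq ax => ->; rewrite ltxx.
have yC : y \in C by rewrite !inE eqxx.
have y'C : y' \in C by rewrite !inE eqxx orbT.
apply: (embedding_inj inj3); rewrite ?L3//.
exact: dim_le0 d3 _ _ yC y'C.
Qed.

Lemma exists_extremal_forest L A f : simplicial_complex L ->
  embedding L f -> {in A, forall x, [set x] \in L} -> dim_le 2 A f ->
  exists2 g : T -> R, {in A &, injective g} & extremal_forest L A g.
Proof.
move=> Lc inj AL dA; have [u uP] := generic_functional f.
exists (fun a => functional u (f a)).
  move=> a b aA bA /eqP h; apply: (embedding_inj inj); rewrite ?AL//.
  by apply/eqP; apply: contraTT h; exact: uP.
move=> w wA; split; first exact: (slope_forest u).
(* The upper side of [w] is the lower side for [- u]. *)
have [e He] := slope_forest (- u) Lc inj AL dA wA; exists e.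
rewrite /= (_ : [set a in A | _] = [set a in A |
  (functional (- u) (f a) < functional (- u) (f w)) && ([set w; a] \in L)])//.
by apply/setP=> a; rewrite !inE !functionalN ltrN2.
Qed.

End Linear.

(** * Complexes covering a convex set *)

From mathcomp Require Import all_classical all_reals convex.
From mathcomp Require Import topology normedtype.
Import numFieldNormedType.Exports.

(** * Locally constant functions on convex sets *)

Section Segment.
Local Open Scope classical_set_scope.
Variables (R : realType) (V : normedModType R).
Implicit Types (x y : V) (U : set V).

Definition segment_point x y (t : R) : V := (1 - t) *: x + t *: y.

Definition segment_convex U := forall x y (t : R), U x -> U y -> 0 <= t <= 1 ->
  U (segment_point x y t).

Lemma segment_point0 x y : segment_point x y 0 = x.
Proof. by rewrite /segment_point subr0 scale1r scale0r addr0. Qed.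

Lemma segment_point1 x y : segment_point x y 1 = y.
Proof. by rewrite /segment_point subrr scale1r scale0r add0r. Qed.

Lemma segment_point_continuous x y : continuous (segment_point x y).
Proof.
move=> t; apply: cvgD; apply: cvgZr_tmp; last exact: cvg_id.
by apply: cvgB; [exact: cvg_cst|exact: cvg_id].
Qed.

(** The set where [F] equals [F 0] is nonempty, open and closed in the connected unit interval. *)
Lemma locally_constant_itv (F : R -> bool) :
  (forall t : R, 0 <= t <= 1 -> \forall s \near t, 0 <= s <= 1 -> F s = F t) ->
  F 0 = F 1.
Proof.
move=> lc; pose B := [set t : R | 0 <= t <= 1 /\ F t = F 0].
have op b : exists2 C : set R, open C &
    forall t : R, 0 <= t <= 1 -> C t <-> F t = b.
  exists [set s : R | 0 <= s <= 1 -> F s = b]°; first exact: open_interior.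
  move=> t t01; split=> [/nbhs_singleton/(_ t01)//|Ft].
  by have := lc t t01; rewrite Ft.
have BE : B = `[0, 1].
  apply: segment_connected.
  - by exists 0; split; rewrite // lexx ler01.
  - have [C Co CP] := op (F 0); exists C => //; apply/seteqP.
    split=> t /=; rewrite in_itv/= => -[t01 h]; split=> //; exact/CP.
  - have [C Co CP] := op (~~ F 0); exists (~` C); first exact: open_closedC.
    apply/seteqP; split=> t /=; rewrite in_itv/= => -[t01 h]; split=> //.
      by move/(CP _ t01); rewrite h; case: (F 0).
    case E: (F t == F 0); first exact/eqP.
    by exfalso; apply/h/CP => //; move: E; case: (F t); case: (F 0).
have : B 1 by rewrite BE /= in_itv/= ler01 lexx.
by case.
Qed.

Lemma locally_constant_convex U (F : V -> bool) : segment_convex U ->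
  (forall x, U x -> \forall y \near x, U y -> F y = F x) ->
  forall x y, U x -> U y -> F x = F y.
Proof.
move=> cU lc x y Ux Uy.
rewrite -[x in LHS](segment_point0 x y) -[y in RHS](segment_point1 x y).
apply: (locally_constant_itv (F := fun t => F (segment_point x y t))) => t t01.
have := @segment_point_continuous x y t _ (lc _ (cU _ _ _ Ux Uy t01)).
by apply: (@filterS _ (nbhs t)) => s h s01; apply: h; exact: cU.
Qed.

End Segment.

(** * Faces attached to the points of a convex body *)

Section Cover.
Local Open Scope classical_set_scope.
Variables (R : realType) (T : finType) (k : nat).
Notation V := ('rV[R]_k).
Variables (L : {set {set T}}) (A : {set T}) (D : set V).
(** The map [supp] attaches to each point of [D] a face that can only grow nearby, and [pk] picks a
    vertex of it. The point [p a] represents the vertex [a], which stays in the support along an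
    edge segment up to its far end. *)
Variables (supp : V -> {set T}) (pk : V -> T) (p : T -> V) (M : R).
Hypotheses (Lc : simplicial_complex L) (Dconv : segment_convex D).
Hypotheses (Dcpt : compact D) (DM : forall x i, D x -> `|x 0 i| <= M).
Hypothesis suppL : forall x, D x -> supp x \in L.
Hypothesis suppA : forall x, D x -> supp x \subset A.
Hypothesis supp_pk : forall x, D x -> pk x \in supp x.
Hypothesis supp_near : forall x, D x ->
  \forall y \near x, D y -> supp x \subset supp y.
Hypothesis Dp : forall a, a \in A -> D (p a).
Hypothesis supp_edge : forall a b (t : R), a \in A -> b \in A ->
  [set a; b]%SET \in L -> 0 <= t < 1 -> a \in supp (segment_point (p a) (p b) t).

Lemma supp_face x (s : {set T}) : D x -> s \subset supp x -> s \in L.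
Proof. by case: Lc => _ Ls Dx; apply: Ls; exact: suppL. Qed.

Lemma in_suppA x a : D x -> a \in supp x -> a \in A.
Proof. by move=> Dx; apply/fintype.subsetP; exact: suppA. Qed.

Lemma cover_edge x a b : D x -> a \in supp x -> b \in supp x ->
  [set a; b]%SET \in L.
Proof.
by move=> Dx ax bx; apply: (supp_face Dx); rewrite finset.subUset !finset.sub1set ax.
Qed.

Lemma supp_vertex a : a \in A -> [set a]%SET \in L -> a \in supp (p a).
Proof.
move=> aA aL; rewrite -[p a](segment_point0 (p a) (p a)).
by apply: supp_edge; rewrite ?finset.setUid// lexx ltr01.
Qed.

(** A function that is constant along edges takes one value on each support, hence defines a locally
    constant function on the convex set [D]. *)
Lemma cover_graph_connected : {in A, forall a, [set a]%SET \in L} -> graph_connected L A.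
Proof.
move=> AL h hh a b aA bA.
have hE x c d : D x -> c \in supp x -> d \in supp x -> h c = h d.
  move=> Dx cx dx; apply: hh; rewrite ?(in_suppA Dx)//.
  exact: cover_edge cx dx.
have E c : c \in A -> h (pk (p c)) = h c.
  by move=> cA; apply: (hE (p c)); rewrite ?supp_pk ?supp_vertex ?AL//; exact: Dp.
rewrite -E// -[RHS]E//.
apply: (locally_constant_convex (F := fun x => h (pk x)) Dconv); try exact: Dp.
move=> x Dx; apply: filterS (supp_near Dx) => y /[swap] Dy /(_ Dy) /fintype.subsetP xy.
by apply: (hE y); rewrite ?supp_pk// xy// supp_pk.
Qed.

Section Cocycle.
Variable c : T -> T -> bool.
Hypothesis cc : cocycle1 L A c.

(* Local primitives of [c] on the supports form a double cover of [D]. *)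
Definition is_section (U : set V) (s : V -> T -> bool) :=
  (forall x, U x -> {in supp x &, forall a b, c a b = s x a (+) s x b}) /\
  (forall x, U x -> \forall y \near x, U y -> {in supp x, s y =1 s x}).

Definition has_section U := exists s, is_section U s.

Lemma has_sectionS U U' : U `<=` U' -> has_section U' -> has_section U.
Proof.
move=> UU [s [s1 s2]]; exists s; split=> [x /UU|x /UU Ux]; first exact: s1.
by apply: filterS (s2 x Ux) => y h /UU; exact: h.
Qed.

(** Where all supports share [a], the function [c a] is a primitive, by the cocycle condition on
    triples containing [a]. *)
Lemma has_section_star a U : U `<=` D -> (forall x, U x -> a \in supp x) ->
  has_section U.
Proof.
move=> UD Ua; exists (fun _ b => c a b); split=> x Ux; last first.
  by apply: (@nearW _ (nbhs x)) => y _ b _.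
move=> b d bx dx; have ax := Ua x Ux; have Dx := UD x Ux.
have := cc (in_suppA Dx ax) (in_suppA Dx bx) (in_suppA Dx dx).
rewrite (supp_face Dx); last by rewrite !finset.subUset !finset.sub1set ax bx.
by move=> /(_ isT); case: (c a b); case: (c a d); case: (c b d).
Qed.

(** On the slice [x 0 j = m] the two sections differ by a value independent of the vertex, both
    being primitives of [c], and of the point, the slice being convex. Adding this constant [q] to
    one section makes them agree. *)
Lemma has_section_glue U (j : 'I_k) m : U `<=` D -> segment_convex U ->
  has_section (U `&` [set x | x 0 j <= m]) ->
  has_section (U `&` [set x | m <= x 0 j]) -> has_section U.
Proof.
move=> UD Uc [s [s1 s2]] [s' [s1' s2']].
pose I := U `&` [set x : V | x 0 j = m].
have Il x : I x -> (U `&` [set x | x 0 j <= m]) x by case=> Ux /= ->; split=> /=.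
have Ir x : I x -> (U `&` [set x | m <= x 0 j]) x by case=> Ux /= ->; split=> /=.
have Ic : segment_convex I.
  move=> x y t [Ux /= xm] [Uy /= ym] t01; split; first exact: Uc.
  by rewrite /= !mxE xm ym; lra.
pose F x := s x (pk x) (+) s' x (pk x).
have FE x a : I x -> a \in supp x -> s x a (+) s' x a = F x.
  move=> Ix ax; have [Ux _] := Ix; have px := supp_pk (UD _ Ux).
  have := s1 x (Il x Ix) a (pk x) ax px; have := s1' x (Ir x Ix) a (pk x) ax px.
  rewrite /F => ->.
  by case: (s x a); case: (s' x a); case: (s x _); case: (s' x _).
have Flc x : I x -> \forall y \near x, I y -> F y = F x.
  move=> Ix; have Dx : D x by apply: UD; case: Ix.
  near=> y => Iy; have Dy : D y by apply: UD; case: Iy.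
  have px := supp_pk Dx.
  have sxy : supp x \subset supp y.
    have : D y -> supp x \subset supp y by near: y; exact: supp_near.
    exact.
  rewrite -(FE y (pk x) Iy); last exact: (fintype.subsetP sxy).
  rewrite /F; congr (_ (+) _).
    have : (U `&` [set x | x 0 j <= m]) y -> {in supp x, s y =1 s x}.
      by near: y; exact: s2 (Il x Ix).
    by move=> /(_ (Il _ Iy)); apply.
  have : (U `&` [set x | m <= x 0 j]) y -> {in supp x, s' y =1 s' x}.
    by near: y; exact: s2' (Ir x Ix).
  by move=> /(_ (Ir _ Iy)); apply.
have [q Fq] : exists q, forall x, I x -> F x = q.
  have [[z Iz]|I0] := pselect (exists z, I z).
    by exists (F z) => x Ix; exact: (locally_constant_convex Ic Flc).
  (* On an empty slice any constant will do. *)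
  by exists true => x Ix; case: I0; exists x.
pose S (x : V) a := if x 0 j <= m then s x a else s' x a (+) q.
have SE x a : U x -> m <= x 0 j -> a \in supp x -> S x a = s' x a (+) q.
  move=> Ux mx ax; rewrite /S; case: ifPn => // xm.
  have Ix : I x by split=> //; apply/eqP; rewrite /= eq_le xm mx.
  by rewrite -(Fq x Ix) -(FE x a Ix ax) [in RHS]addbC addbK.
exists S; split=> x Ux.
  move=> a b ax bx; have [xm|mx] := leP (x 0 j) m.
    by rewrite /S xm; apply: s1.
  rewrite !SE ?ltW// (s1' x _ a b ax bx); last by split=> //=; exact: ltW.
  by case: (s' x a); case: (s' x b); case: q {Fq S SE}.
have cj : (fun y : V => y 0 j) y @[y --> x] --> x 0 j by exact: coord_continuous.
have [xm|mx|xm] := ltgtP (x 0 j) m.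
- have /= xn : \forall y \near x, (y : V) 0 j < m := cj _ (lt_nbhsl xm).
  near=> y => Uy a ax; have ym : y 0 j < m by near: y.
  rewrite /S !ltW//; have : (U `&` [set x | x 0 j <= m]) y -> {in supp x, s y =1 s x}.
    by near: y; apply: s2; split=> //=; exact: ltW.
  by move=> h; apply: h => //; split=> //=; exact: ltW.
- have /= xn : \forall y \near x, m < (y : V) 0 j := cj _ (lt_nbhsr mx).
  near=> y => Uy a ax; have ym : m < y 0 j by near: y.
  have sxy : supp x \subset supp y.
    have : D y -> supp x \subset supp y by near: y; exact/supp_near/UD.
    by move/(_ (UD y Uy)).
  rewrite !SE ?ltW//; last exact: (fintype.subsetP sxy).
  congr (_ (+) _); have : (U `&` [set x | m <= x 0 j]) y -> {in supp x, s' y =1 s' x}.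
    by near: y; apply: s2'; split=> //=; exact: ltW.
  by move=> h; apply: h => //; split=> //=; exact: ltW.
(* Points near the slice may lie on either side; at [x] itself both formulas for [S] hold. *)
- have Ix : I x by split.
  near=> y => Uy a ax.
  have sxy : supp x \subset supp y.
    have : D y -> supp x \subset supp y by near: y; exact/supp_near/UD.
    by move/(_ (UD y Uy)).
  have [ym|my] := leP (y 0 j) m.
    rewrite /S ym xm lexx.
    have : (U `&` [set x | x 0 j <= m]) y -> {in supp x, s y =1 s x}.
      by near: y; apply: s2; exact: Il.
    by move=> h; apply: h => //; split.
  rewrite (SE x a Ux)// ?xm// (SE y a Uy (ltW my)); last exact: (fintype.subsetP sxy).
  congr (_ (+) _); have : (U `&` [set x | m <= x 0 j]) y -> {in supp x, s' y =1 s' x}.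
    by near: y; apply: s2'; exact: Ir.
  by move=> h; apply: h => //; split=> //=; exact: ltW.
Unshelve. all: by end_near.
Qed.

(** Near [x] the vertex [pk x] stays in the support, so small balls have a section. Compactness
    makes the radius uniform, as for a Lebesgue number. *)
Lemma has_section_ball :
  exists2 e : R, 0 < e & forall x, D x -> has_section (D `&` ball x e).
Proof.
have cov := (compact_near_coveringP D).1 Dcpt R 0^'+
  (fun e x => has_section (D `&` ball x e)) _.
have /cov : forall x, D x -> \forall x' \near x & e \near 0^'+,
    has_section (D `&` ball x' e).
  move=> x Dx; have /nbhs_ballP[d /= d0 dP] := supp_near Dx.
  have d2 : 0 < d / 2 by rewrite divr_gt0.
  near=> x' e; apply: (has_section_star (a := pk x)) => [y []//|y [Dy x'y]].
  apply: (fintype.subsetP (dP y _ Dy)); last exact: supp_pk.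
  have xx' : ball x (d / 2) x' by near: x'; exact: (near_ball x _ d2).
  have ed : e < d / 2 by near: e; exact: nbhs_right_lt.
  by rewrite [d]splitr; exact: ball_triangle xx' (le_ball (ltW ed) x'y).
move=> h; have /filter_ex[e [e0 he]] : \forall e \near 0^'+, 0 < e /\
    (D `<=` (fun x => has_section (D `&` ball x e))).
  near=> e; split; first by near: e; exact: nbhs_right_gt.
  by near: e.
by exists e.
Unshelve. all: by end_near.
Qed.

(* Cut [U] into slices of width e/2 in one coordinate after the other. *)
Lemma has_section_slices e (n : nat) U : 0 < e ->
  (forall x, D x -> has_section (D `&` ball x e)) ->
  U `<=` D -> segment_convex U ->
  (forall x y (i : 'I_k), U x -> U y -> (n <= i)%N -> `|x 0 i - y 0 i| < e) ->
  has_section U.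
Proof.
move=> e0 he; elim: n U => [|n IH] U UD Uc small.
  (* All coordinates now vary by less than [e], so in the sup norm [U] lies in one ball. *)
  have [[x Ux]|U0] := pselect (exists x, U x).
    apply: has_sectionS (he x (UD x Ux)) => y Uy; split; first exact: UD.
    by split=> // i j; rewrite (ord1 i); exact: small.
  exists (fun _ _ => true); split=> x Ux; by case: U0; exists x.
have [nk|kn] := ltnP n k; last first.
  apply: IH => // x y i Ux Uy ni; apply: small => //.
  by move: (leq_trans kn ni); rewrite leqNgt ltn_ord.
pose j := Ordinal nk.
(* Cut off the top slice, of width [e / 2 < e], and glue it back. In a slab of thickness 0 the
   coordinate [j] is constant. *)
have slab N l U' : U' `<=` U -> segment_convex U' ->
    (forall x, U' x -> l <= x 0 j <= l + N%:R * (e / 2)) -> has_section U'.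
  elim: N l U' => [|N IHN] l U' U'U U'c U'l.
    apply: IH => //; first exact: subset_trans UD.
    move=> x y i Ux Uy; rewrite leq_eqVlt => /orP[/eqP ni|]; last by apply: small; exact: U'U.
    rewrite (_ : i = j); last exact: val_inj.
    have := U'l x Ux; have := U'l y Uy; rewrite mul0r addr0.
    by rewrite -!eq_le => /eqP<- /eqP<-; rewrite subrr normr0.
  have conv2 (P : R -> Prop) : (forall a b t, P a -> P b -> 0 <= t <= 1 -> P ((1 - t) * a + t * b)) ->
      segment_convex (U' `&` [set x : V | P (x 0 j)]).
    move=> Pc x y t [Ux Px] [Uy Py] t01; split; first exact: U'c.
    by rewrite /= !mxE; exact: Pc.
  apply: (has_section_glue (j := j) (m := l + N%:R * (e / 2))) => //.
  - exact: subset_trans UD.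
  - apply: (IHN l).
    + by move=> x [/U'U].
    + by apply: (conv2 (fun r => r <= l + N%:R * (e / 2))) => a b t *; nra.
    + by move=> x [/U'l/andP[-> _]] /= ->.
  - apply: IH.
    + by move=> x [/U'U/UD].
    + by apply: (conv2 (fun r => l + N%:R * (e / 2) <= r)) => a b t *; nra.
    + move=> x y i [Ux xl] [Uy yl]; rewrite leq_eqVlt => /orP[/eqP ni|]; last first.
        by apply: small; exact: U'U.
      rewrite (_ : i = j); last exact: val_inj.
      move: (U'l x Ux) (U'l y Uy) xl yl; rewrite -natr1 mulrDl mul1r /=.
      by move=> /andP[_ xu] /andP[_ yu] xl yl; rewrite ltr_norml; apply/andP; split; lra.
(* More than [4 * M / e] slices of width [e / 2] exhaust the range from [- M] to [M]. *)
pose N := Num.bound `|4 * M / e|.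
apply: (slab N (- M)) => // x /UD/(DM j); rewrite ler_norml => /andP[-> xM] /=.
apply: le_trans xM _; have := archi_boundP (normr_ge0 (4 * M / e)).
rewrite -/N => /(le_lt_trans (ler_norm _)); rewrite ltr_pdivrMr//.
by move=> h; lra.
Qed.

Lemma has_section_all : has_section D.
Proof.
have [e e0 he] := has_section_ball.
apply: (has_section_slices (n := k) e0 he) => // x y i _ _.
by rewrite leqNgt ltn_ord.
Qed.

End Cocycle.

(** Take at [a] the value of a global section at [p a]. It does not change on the way to the
    midpoint of [p a] and [p b], whose support contains both [a] and [b]; there the section is a
    primitive of [c]. *)
Lemma cover_acyclic1 : acyclic1 L A.
Proof.
move=> c cc; have [s [s1 s2]] := has_section_all cc.
exists (fun a => s (p a) a) => a b aA bA abL.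
pose m := segment_point (p a) (p b) 2^-1.
have mid x y : x \in A -> y \in A -> [set x; y]%SET \in L ->
    s (p x) x = s (segment_point (p x) (p y) 2^-1) x.
  move=> xA yA xyL.
  have half (t : R) : 0 <= t <= 1 -> 0 <= t / 2 <= 1 by lra.
  have half1 (t : R) : 0 <= t <= 1 -> 0 <= t / 2 < 1 by lra.
  have Ds (t : R) : 0 <= t <= 1 -> D (segment_point (p x) (p y) (t / 2)).
    by move=> /half t2; apply: Dconv => //; exact: Dp.
  pose F (t : R) := s (segment_point (p x) (p y) (t / 2)) x.
  suff : F 0 = F 1 by rewrite /F mul0r segment_point0 mul1r.
  apply: locally_constant_itv => t t01.
  have cont : continuous (fun t : R => segment_point (p x) (p y) (t / 2)).
    move=> r; apply: continuous_comp; last exact: segment_point_continuous.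
    by apply: cvgMr_tmp; exact: cvg_id.
  have := cont t _ (s2 _ (Ds t t01)).
  apply: (@filterS _ (nbhs t)) => r h r01; apply: h; first exact: Ds.
  exact/supp_edge/half1.
have Dm : D m by apply: Dconv; [exact: Dp|exact: Dp|lra].
have am : a \in supp m by apply: supp_edge => //; lra.
have mE : m = segment_point (p b) (p a) 2^-1.
  by rewrite /m /segment_point addrC; congr (_ *: _ + _ *: _); lra.
have bm : b \in supp m by rewrite mE; apply: supp_edge; rewrite // 1?finset.setUC//; lra.
by rewrite (mid a b)// (mid b a) 1?finset.setUC// -mE -/m; exact: s1.
Qed.

End Cover.

(** * The carrier of a point *)

Lemma continuous_sum (R : realType) (U : topologicalType) (V : normedModType R)
    (I : finType) (F : I -> U -> V) :
  (forall i, continuous (F i)) -> continuous (fun x => \sum_i F i x).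
Proof.
move=> cF x; apply: (@cvg_big _ _ _ _ _ add_continuous _ (nbhs x)) => i _.
exact: cF.
Qed.

Section Carrier.
Local Open Scope classical_set_scope.
Variables (R : realType) (T : finType) (k : nat).
Notation V := ('rV[R]_k).
Implicit Types (K : {set {set T}}) (f : T -> V) (s : {set T}) (w : T -> R).

Definition hull f s : set V := [set x | exists w,
  [/\ forall a, 0 <= w a, \sum_a w a = 1, forall a, a \notin s -> w a = 0 &
      x = \sum_a w a *: f a]].

(** A continuous image of a closed simplex: a box with the coordinates off [s] pinned to 0, cut by
    the condition that the sum is 1. *)
Lemma compact_hull f s : compact (hull f s).
Proof.
pose n := #|T|; pose cf (v : 'rV[R]_n) (a : T) := v 0 (enum_rank a).
have cfc a : continuous (cf ^~ a) by exact: coord_continuous.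
pose E (i : 'I_n) : set R := if enum_val i \in s then `[0, 1] else [set 0].
pose B := [set v : 'rV[R]_n | forall i, E i (v ord0 i)].
have Bc : compact B.
  apply: (@rV_compact R n E) => i; rewrite /E.
  by case: ifP => _; [exact: segment_compact|exact: compact_set1].
pose sum1 := [set v : 'rV[R]_n | \sum_a cf v a = 1].
have sum1c : closed sum1.
  apply: (@preimage_closed _ _ (fun v : 'rV[R]_n => \sum_a cf v a) [set 1]).
    by move=> v _; apply: continuous_sum.
  exact/accessible_closed_set1/hausdorff_accessible/Rhausdorff.
suff -> : hull f s = [set \sum_a cf v a *: f a | v in B `&` sum1].
  apply: continuous_compact; last exact: compact_closedI.
  apply: continuous_subspaceT; apply: continuous_sum => a v.
  by apply: (@cvgZr_tmp _ _ _ (nbhs v)); exact: cfc.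
apply/seteqP; split=> x /=.
  move=> [w [w0 w1 ws ->]]; exists (\row_i w (enum_val i)); last first.
    by apply: eq_bigr => a _; rewrite /cf mxE enum_rankK.
  split=> [i|/=]; rewrite ?mxE.
    rewrite /E; case: ifPn => [_|/ws->//] /=; rewrite in_itv/= w0 -w1 (bigD1 (enum_val i))//=.
    by rewrite lerDl sumr_ge0.
  by rewrite /sum1 /= -w1; apply: eq_bigr => a _; rewrite /cf mxE enum_rankK.
move=> [v [vB v1] <-]; exists (cf v); split=> // a.
  have := vB (enum_rank a); rewrite /E enum_rankK; case: ifP => _ /=.
    by rewrite in_itv/= => /andP[].
  by rewrite /cf => ->.
by move=> /negbTE aS; have := vB (enum_rank a); rewrite /E enum_rankK aS.
Qed.

Definition support w : {set T} := [set a | w a != 0]%SET.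

Lemma weight_mass K w s : simplicial_complex K ->
  mass w -> s \in K -> support w \subset s -> weight K w.
Proof. by move=> [_ Ks] [w0 w1] sK ws; split=> //; exact: Ks ws. Qed.

Lemma mass_conv w w' (t : R) : 0 <= t <= 1 -> mass w -> mass w' ->
  mass (fun x => (1 - t) * w x + t * w' x).
Proof.
move=> /andP[t0 t1] [w0 w1] [w0' w1']; split=> [x|].
  by rewrite addr_ge0// mulr_ge0// subr_ge0.
by rewrite big_split/= -!mulr_sumr w1 w1'; lra.
Qed.

Lemma sum_conv w w' f (t : R) :
  \sum_x ((1 - t) * w x + t * w' x) *: f x =
  segment_point (\sum_x w x *: f x) (\sum_x w' x *: f x) t.
Proof.
rewrite /segment_point !scaler_sumr -big_split/=; apply: eq_bigr => x _.
by rewrite scalerDl !scalerA.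
Qed.

Definition body K f : set V :=
  [set x | exists2 w, weight K w & x = \sum_a w a *: f a].

Section Bary.
Variables (K : {set {set T}}) (f : T -> V) (bary : V -> T -> R).
Hypotheses (Kc : simplicial_complex K) (inj : embedding K f).
Hypothesis baryP : forall x, body K f x ->
  weight K (bary x) /\ x = \sum_a bary x a *: f a.
Hypothesis Xconv : segment_convex (body K f).

Let X := body K f.
Definition carrier x := support (bary x).

Lemma carrier_face x : X x -> carrier x \in K.
Proof. by move=> /baryP[[_ _]]. Qed.

Lemma bary_unique w : weight K w -> bary (\sum_a w a *: f a) =1 w.
Proof.
move=> wK; have Xw : X (\sum_a w a *: f a) by exists w.
have [bK be] := baryP Xw; exact: inj.
Qed.

Lemma in_carrier w a : weight K w ->
  (a \in carrier (\sum_a w a *: f a)) = (w a != 0).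
Proof. by move=> wK; rewrite finset.inE bary_unique. Qed.

Lemma body_hull x : X x -> hull f (carrier x) x.
Proof.
move=> /baryP[[w0 w1 wK] xE]; exists (bary x); split=> // a.
by rewrite finset.inE negbK => /eqP.
Qed.

(** Finitely many closed hulls miss [x], so points [y] near [x] avoid them all. Hence [x] lies in
    the hull of the carrier of [y], and uniqueness of weights places its carrier in that face. *)
Lemma carrier_near x : X x -> \forall y \near x, X y -> carrier x \subset carrier y.
Proof.
move=> Xx; have n : \forall y \near x, forall s : {set T},
    ~ hull f s x -> ~ hull f s y.
  apply: (@filter_forall _ _ _ (nbhs x)) => s; have [xs|xs] := pselect (hull f s x).
    by apply: (@nearW _ (nbhs x)).
  have : nbhs x (~` hull f s).
    apply: open_nbhs_nbhs; split=> //; apply: closed_openC.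
    by apply: compact_closed; [exact: norm_hausdorff|exact: compact_hull].
  by apply: (@filterS _ (nbhs x)) => y ys _.
move: n; apply: (@filterS _ (nbhs x)) => y ny Xy.
have [w [w0 w1 ws xE]] : hull f (carrier y) x.
  by apply: contrapT => h; apply: (ny _ h); exact: body_hull.
have wy : support w \subset carrier y.
  by apply/fintype.subsetP => a; rewrite finset.inE; apply: contraNT => /ws->.
have wK : weight K w by apply: weight_mass wy => //; exact: carrier_face.
apply: fintype.subset_trans wy; apply/fintype.subsetP => a.
by rewrite xE in_carrier// finset.inE.
Qed.

Lemma body_vertex a : a \in vertices K -> X (f a).
Proof.
move=> aK; exists (fun x => (x == a)%:R); last by rewrite sum_delta.
by apply: weight_delta; rewrite -in_vertices.
Qed.

Lemma carrier_vertex a b : a \in vertices K -> (b \in carrier (f a)) = (b == a).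
Proof.
move=> aK; rewrite -[f a in LHS]sum_delta in_carrier.
  by rewrite pnatr_eq0 eqb0 negbK.
by apply: weight_delta; rewrite -in_vertices.
Qed.

Lemma closed_body : closed X.
Proof.
suff -> : X = \bigcup_(s in [set s | s \in K]) hull f s.
  apply: closed_bigcup => [|s _]; first exact: finite_finset.
  by apply: compact_closed; [exact: norm_hausdorff|exact: compact_hull].
apply/seteqP; split=> [x Xx|x [s /= sK [w [w0 w1 ws ->]]]].
  by exists (carrier x); [exact: carrier_face|exact: body_hull].
exists w => //; apply: (weight_mass Kc _ sK) => //.
by apply/fintype.subsetP => a; rewrite finset.inE; apply: contraNT => /ws->.
Qed.

Lemma carrier_segment x y : X x -> X y -> exists t : R,
  [/\ 0 < t, t < 1 & carrier x \subset carrier (segment_point x y t)].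
Proof.
move=> Xx Xy; have c0 := @segment_point_continuous R V x y 0.
rewrite /continuous_at segment_point0 in c0.
have /nbhs_ballP[d /= d0 dP] := c0 _ (carrier_near Xx).
pose t := Num.min (d / 2) (1 / 2).
have t0 : 0 < t by rewrite lt_min; apply/andP; split; lra.
have td : t <= d / 2 by rewrite ge_min lexx.
have t1 : t <= 1 / 2 by rewrite ge_min lexx orbT.
exists t; split=> //; first lra.
apply: (dP t); first by rewrite /ball /= sub0r normrN gtr0_norm//; lra.
by apply: Xconv => //; lra.
Qed.

(* Near the barycentre of a top-dimensional face, the segment towards any vertex
   stays in that face. *)
Lemma dim_le_vertices n s : s \in K -> #|s| = n.+1 ->
  (forall s', s' \in K -> (#|s'| <= n.+1)%N) -> dim_le n (vertices K) f.
Proof.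
move=> sK sn Kn; have [s0 s0s] : exists s0 : T, s0 \in s.
  by apply/finset.set0Pn; rewrite -finset.card_gt0 sn.
pose r : R := n.+1%:R^-1; pose wm a : R := if a \in s then r else 0.
have r0 : 0 < r by rewrite invr_gt0 ltr0n.
have wmK : weight K wm.
  split=> [a|| ]; first by rewrite /wm; case: ifP => // _; exact: ltW.
    by rewrite -big_mkcond/= sumr_const sn -[RHS](mulVf (lt0r_neq0 r0)) /r invrK mulrC mulr_natr.
  rewrite (_ : [set a | wm a != 0]%SET = s)//; apply/setP=> a; rewrite finset.inE /wm.
  by case: ifP; rewrite ?eqxx ?gt_eqF.
pose m := \sum_a wm a *: f a.
have Xm : X m by exists wm.
have sm : carrier m = s.
  by apply/setP=> a; rewrite in_carrier// /wm; case: ifP; rewrite ?eqxx ?gt_eqF.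
pose W : 'M[R]_(#|s :\ s0|%SET, k) := \matrix_i (f (enum_val i) - f s0).
have Ws a : a \in s -> (f a - f s0 <= W)%MS.
  move=> aS; have [->|as0] := eqVneq a s0; first by rewrite subrr sub0mx.
  have aS0 : a \in (s :\ s0)%SET by rewrite finset.in_setD1 as0.
  by rewrite -(enum_rankK_in aS0 aS0) -(rowK (fun i => f (enum_val i) - f s0)) row_sub.
have WX x : X x -> carrier x = s -> (x - f s0 <= W)%MS.
  move=> Xx xs; have [[w0 w1 wK] xE] := baryP Xx.
  have -> : x - f s0 = \sum_a bary x a *: (f a - f s0).
    rewrite {1}xE; under [RHS]eq_bigr do rewrite scalerBr.
    by rewrite sumrB -scaler_suml w1 scale1r.
  apply: summx_sub => a _; have [aS|] := boolP (a \in s).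
    by apply: scalemx_sub; exact: Ws.
  move=> aS; have : a \notin carrier x by rewrite xs.
  by rewrite finset.inE negbK => /eqP->; rewrite scale0r sub0mx.
have WK y : y \in vertices K -> (f y - f s0 <= W)%MS.
  move=> yK; have Xy := body_vertex yK.
  have [t [t0 t1 mt]] := carrier_segment Xm Xy.
  have Xt : X (segment_point m (f y) t) by apply: Xconv => //; lra.
  (* The carrier contains [s], and no face has more vertices than [s]. *)
  have ts : carrier (segment_point m (f y) t) = s.
    by apply/esym/eqP; rewrite finset.eqEcard sn Kn ?carrier_face// andbT -sm.
  (* Two points of the line through [m] and [f y] lie in the affine span of [s], hence so does
     [f y]. *)
  have -> : f y - f s0 = t^-1 *: ((segment_point m (f y) t - f s0) - (1 - t) *: (m - f s0)).
    apply: (scalerI (lt0r_neq0 t0)); rewrite scalerA mulfV ?gt_eqF// scale1r.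
    rewrite /segment_point !scalerBr !scalerBl !scale1r.
    by apply/rowP=> i; rewrite !mxE; lra.
  by rewrite scalemx_sub// addmx_sub ?eqmx_opp ?scalemx_sub ?WX.
exists <<W>>%MS; first by rewrite genmxE (leq_trans (rank_leq_row _))// -ltnS -sn (cardsD1 s0 s) s0s.
move=> a b aK bK; rewrite genmxE -[f a](subrK (f s0)) -addrA -[f s0 - _]opprB.
by rewrite addmx_sub ?eqmx_opp ?WK.
Qed.

End Bary.
End Carrier.

(** * Descending links *)

Section DescendingLink.
Local Open Scope classical_set_scope.
Variables (R : realType) (T : finType) (k : nat).
Notation V := ('rV[R]_k).
Variables (K : {set {set T}}) (f : T -> V) (bary : V -> T -> R).
Hypotheses (Kc : simplicial_complex K) (inj : embedding K f).
Hypothesis baryP : forall x, body K f x ->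
  weight K (bary x) /\ x = \sum_a bary x a *: f a.
Hypothesis Xconv : segment_convex (body K f).
Variables (u : 'cV[R]_k) (v : T).
Hypothesis vK : v \in vertices K.

Let X := body K f.
Let h a := functional u (f a).
Let A := [set a in vertices K | (h a < h v) && ([set v; a]%SET \in K)]%SET.
Let L := induced (link K v) A.
Let carr := carrier bary.

Lemma functional_segment x y (t : R) : functional u (segment_point x y t) =
  (1 - t) * functional u x + t * functional u y.
Proof. by rewrite /functional /segment_point mulmxDl -!scalemxAl !mxE. Qed.

(** The height of [x] is a weighted mean of the heights of the vertices in its carrier. *)
Lemma low_vertex x : X x -> functional u x < h v ->
  exists2 a, a \in carr x & h a < h v.
Proof.
move=> Xx; have [[w0 w1 _] xE] := baryP Xx; rewrite {1}xE functional_sum => lt.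
apply: contrapT => no; move: lt; apply/negP; rewrite -leNgt.
rewrite -[h v]mul1r -w1 mulr_suml; apply: ler_sum => a _.
have [ax|] := boolP (a \in carr x).
  by apply: ler_wpM2l => //; rewrite leNgt; apply/negP => av; apply: no; exists a.
by rewrite finset.inE negbK => /eqP->; rewrite !mul0r.
Qed.

Lemma descending_mem x a : X x -> v \in carr x -> a \in carr x -> h a < h v -> a \in A.
Proof.
move=> Xx vx ax av; have [_ Ks] := Kc; have xK := carrier_face baryP Xx.
rewrite finset.inE av in_vertices !(Ks _ _ xK)//; rewrite ?finset.sub1set//.
by rewrite finset.subUset !finset.sub1set vx.
Qed.

(** A short step from [f v] towards [f y] keeps [v] in the carrier and goes below [h v], so the
    carrier also has a vertex below [v]. *)
Lemma descending_neq0 y : y \in vertices K -> h y < h v -> A != finset.set0.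
Proof.
move=> yK yv; have Xv : X (f v) := body_vertex f vK.
have Xy : X (f y) := body_vertex f yK.
have [t [t0 t1 vt]] := carrier_segment Kc inj baryP Xconv Xv Xy.
have Xt : X (segment_point (f v) (f y) t) by apply: Xconv => //; lra.
have [|a at' av] := low_vertex Xt.
  by move: yv; rewrite functional_segment /h => yv; nra.
apply/finset.set0Pn; exists a; apply: descending_mem Xt _ at' av.
by apply: (fintype.subsetP vt); rewrite (carrier_vertex inj baryP).
Qed.

Lemma descending_complex : simplicial_complex L.
Proof. by apply/induced_complex/link_complex; rewrite // -in_vertices. Qed.

Lemma descending_vertex a : a \in A -> [set a]%SET \in L.
Proof.
move=> aA; move: (aA); rewrite finset.inE => /and3P[_ av vaK].
rewrite in_induced link_vertex// vaK finset.sub1set aA !andbT.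
by apply: contraTneq av => ->; rewrite ltxx.
Qed.

(* The part of the convex body [X] in a small box around [f v] and slightly
   below [f v] is covered by the descending link. *)
Lemma descending_link_topology : graph_connected L A /\ acyclic1 L A.
Proof.
have Xv : X (f v) := body_vertex f vK.
have [d /= d0 dP] := (nbhs_ballP _ _).1 (carrier_near Kc inj baryP Xv).
pose N a := \sum_i `|f a 0 i - f v 0 i|.
have N0 a : 0 <= N a by apply: sumr_ge0.
have gA a : a \in A -> 0 < h v - h a by rewrite finset.inE subr_gt0 => /and3P[].
(* The level [h v - e] has to meet each segment from [f v] to [f a] in its first half and inside the
   box of half-width [d / 2]. The coordinates of [f a - f v] are bounded by [N a]. *)
have [e [e0 eA]] : exists e : R, 0 < e /\ forall a, a \in A ->
    e < (h v - h a) / 2 /\ e < (h v - h a) * (d / 2) / (1 + N a).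
  have /filter_ex[e [e0 eA]] : \forall e \near 0^'+, 0 < e /\ forall a, a \in A ->
      e < (h v - h a) / 2 /\ e < (h v - h a) * (d / 2) / (1 + N a).
    near=> e; split; first by near: e; exact: nbhs_right_gt.
    near: e; apply: filter_forall => a; have [aA|aA] := boolP (a \in A); last first.
      by near=> e => /negP; rewrite ?aA.
    have g0 := gA a aA; have b0 : 0 < (h v - h a) * (d / 2) / (1 + N a).
      by apply: divr_gt0; [apply: mulr_gt0; lra|have := N0 a; lra].
    near=> e => _; split; near: e; apply: nbhs_right_lt => //.
    by rewrite divr_gt0.
  by exists e.
(* The parameter at which the segment from [f v] to [f a] reaches height [h v - e]. *)
pose s a := e / (h v - h a).
have s0 a : a \in A -> 0 < s a by move=> /gA g0; rewrite divr_gt0.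
have s1 a : a \in A -> s a < 1 / 2.
  move=> aA; have [e1 _] := eA a aA; rewrite ltr_pdivrMr ?gA//.
  by rewrite mul1r mulrC.
have sN a : a \in A -> s a * N a <= d / 2.
  move=> aA; have g0 := gA a aA; have [_] := eA a aA.
  have N1 : 0 < 1 + N a by have := N0 a; lra.
  rewrite ltr_pdivlMr// => e2; rewrite /s mulrAC ler_pdivrMr//.
  by rewrite [leRHS]mulrC; apply: le_trans (ltW e2); rewrite ler_pM2l// lerDr.
pose p a := segment_point (f v) (f a) (s a).
pose Box := [set x : V | forall i, `[f v 0 i - d / 2, f v 0 i + d / 2] (x ord0 i)].
pose H := [set x : V | functional u x <= h v - e].
(* Carriers contain [v] in the box and a vertex lower than [v] in [H], so on [D] they yield nonempty
   faces of the descending link. *)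
pose D := (Box `&` X) `&` H.
have Boxc : compact Box.
  apply: (@rV_compact R k (fun i => `[f v 0 i - d / 2, f v 0 i + d / 2])) => i.
  exact: segment_compact.
have Hc : closed H.
  apply: (@preimage_closed _ _ (functional u) [set r | r <= h v - e]); last exact: closed_le.
  move=> x _; rewrite /functional; under eq_fun do rewrite mxE.
  apply: continuous_sum => i y.
  by apply: (@cvgMr_tmp _ _ (nbhs y)); exact: coord_continuous.
have Dc : compact D.
  apply: compact_closedI Hc; apply: compact_closedI Boxc _.
  exact: closed_body Kc baryP.
have Dconv : segment_convex D.
  move=> x y t [[Bx Xx] Hx] [[By Xy] Hy] /andP[t0 t1]; split; last first.
    by rewrite /H /= functional_segment; move: Hx Hy; rewrite /H /=; nra.
  split; last by apply: Xconv; rewrite ?t0.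
  move=> i; have := Bx i; have := By i; rewrite /= !in_itv/= !mxE.
  move=> /andP[b1 b2] /andP[b3 b4]; apply/andP; split; nra.
have vD x : D x -> v \in carr x.
  move=> [[Bx Xx] _]; have xv : ball (f v) d x.
    split=> // i j; rewrite (ord1 i) /ball /= ltr_norml.
    have := Bx j; rewrite /= in_itv/= => /andP[b1 b2]; apply/andP; split; lra.
  by apply: (fintype.subsetP (dP x xv Xx)); rewrite (carrier_vertex inj baryP).
pose supp x := [set a in carr x | h a < h v]%SET.
have suppE x a : (a \in supp x) = (a \in carr x) && (h a < h v).
  by rewrite [LHS]finset.inE.
(* The default [v] does not occur on [D], where [supp x] is nonempty. *)
pose pk x := odflt v [pick a in supp x].
have suppA x : D x -> supp x \subset A.
  move=> Dx; apply/fintype.subsetP => a; rewrite suppE => /andP[ax av].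
  by have [[_ Xx] _] := Dx; exact: descending_mem Xx (vD x Dx) ax av.
have suppL x : D x -> supp x \in L.
  move=> Dx; have [[_ Xx] _] := Dx; have [_ Ks] := Kc.
  have xK := carrier_face baryP Xx; rewrite in_induced suppA// andbT in_link.
  have sx : supp x \subset carr x.
    by apply/fintype.subsetP => a; rewrite suppE => /andP[].
  apply/and3P; split; [exact: Ks sx|by rewrite suppE ltxx andbF|apply: Ks xK _].
  by rewrite finset.subUset finset.sub1set vD.
have supp_pk x : D x -> pk x \in supp x.
  move=> [[_ Xx] Hx]; have [|a ax av] := low_vertex Xx.
    by apply: le_lt_trans Hx _; rewrite ltrBlDr ltrDl.
  rewrite /pk; case: pickP => [//|/(_ a)].
  by rewrite suppE ax av.
have supp_near x : D x -> \forall y \near x, D y -> supp x \subset supp y.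
  move=> [[_ Xx] _]; have := carrier_near Kc inj baryP Xx.
  apply: (@filterS _ (nbhs x)) => y xy [[_ Xy] _].
  apply/fintype.subsetP => a; rewrite !suppE => /andP[ax ->].
  by rewrite (fintype.subsetP (xy Xy)).
have Dp a : a \in A -> D (p a).
  move=> aA; have sa0 := s0 a aA; have sa1 := s1 a aA; have g0 := gA a aA.
  have aK : a \in vertices K by move: aA; rewrite finset.inE => /and3P[].
  split; last first.
    rewrite /H /= functional_segment -/(h v) -/(h a).
    suff -> : e = s a * (h v - h a) by lra.
    by rewrite /s divfK ?gt_eqF.
  split; last by apply: Xconv; [exact: body_vertex|exact: body_vertex|lra].
  move=> i; rewrite /= in_itv/= /p /segment_point !mxE.
  have : `|s a * (f a 0 i - f v 0 i)| <= d / 2.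
    apply: le_trans (sN a aA); rewrite normrM gtr0_norm// ler_pM2l//.
    by rewrite /N (bigD1 i)//= lerDl sumr_ge0.
  by rewrite ler_norml => /andP[b1 b2]; apply/andP; split; lra.
have supp_edge a b (t : R) : a \in A -> b \in A -> [set a; b]%SET \in L ->
    0 <= t < 1 -> a \in supp (segment_point (p a) (p b) t).
  move=> aA bA abL /andP[t0 t1].
  have := abL; rewrite in_induced link_edge// => /andP[/and3P[va vb vabK] _].
  (* Barycentric coordinates of [p c]. At parameter [t] between [p a] and [p b], the vertex [a] has
     weight at least [(1 - t) * s a > 0]. *)
  pose wt c x : R := (1 - s c) * (x == v)%:R + s c * (x == c)%:R.
  have wtm c : c \in A -> mass (wt c).
    move=> cA; apply: mass_conv; [|exact: mass_delta|exact: mass_delta].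
    by have := s0 c cA; have := s1 c cA; lra.
  have wtE c : \sum_x wt c x *: f x = p c by rewrite sum_conv !sum_delta.
  pose W x : R := (1 - t) * wt a x + t * wt b x.
  have WK : weight K W.
    apply: (weight_mass Kc _ vabK).
      by apply: mass_conv; [rewrite t0 ltW|exact: wtm|exact: wtm].
    apply/fintype.subsetP => x; rewrite !finset.inE; apply: contraNT.
    rewrite !negb_or -andbA => /and3P[/negbTE xv /negbTE xa /negbTE xb].
    by rewrite /W /wt xv xa xb !mulr0 !addr0 !mulr0 addr0.
  have av : h a < h v by rewrite -subr_gt0 gA.
  rewrite suppE av andbT -!wtE -sum_conv.
  rewrite (in_carrier inj baryP _ WK) /W /wt eqxx [a == v]eq_sym (negbTE va).
  rewrite !mulr0 !add0r mulr1 gt_eqF// ltr_wpDr//.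
    by apply: mulr_ge0 => //; apply: mulr_ge0; [exact/ltW/s0|exact: ler0n].
  by rewrite mulr_gt0 ?s0// subr_gt0.
pose M := \sum_i `|f v 0 i| + d / 2.
have DM x i : D x -> `|x 0 i| <= M.
  move=> [[Bx _] _]; have := Bx i; rewrite /= in_itv/= => xi.
  have vi : `|f v 0 i| <= \sum_i `|f v 0 i| by rewrite (bigD1 i)//= lerDl sumr_ge0.
  by move: vi xi; rewrite /M !ler_norml => /andP[c1 c2] /andP[b1 b2]; apply/andP; split; lra.
split.
  exact: (cover_graph_connected descending_complex Dconv suppL suppA supp_pk supp_near Dp
    supp_edge descending_vertex).
exact: (cover_acyclic1 descending_complex Dconv Dc DM suppL suppA supp_pk supp_near Dp
    supp_edge).
Unshelve. all: by end_near.
Qed.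

(** Projection from [f v] lowers dimension 3 to 2 and keeps the embedding, which leaves the planar
    case. *)
Lemma nonevasive_descending_link y : dim_le 3 (vertices K) f ->
  y \in vertices K -> h y < h v ->
  nonevasive (induced (link K v) [set a in vertices K | h a < h v]%SET).
Proof.
move=> d3 yK yv.
have hA : {in A, forall a, functional u (f a) < functional u (f v)}.
  by move=> a; rewrite finset.inE => /and3P[].
have injL : embedding L (slope u f v) by exact: embedding_slope.
have d2 : dim_le 2 A (slope u f v).
  apply: dim_le_link hA; apply: dim_leS d3; rewrite finset.subUset finset.sub1set vK.
  by apply/fintype.subsetP => a; rewrite finset.inE => /and3P[].
have [g gi gf] := exists_extremal_forest descending_complex injL descending_vertex d2.
have [co ac] := descending_link_topology.
have := nonevasive_planar descending_complex descending_vertex gi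
  (descending_neq0 yK yv) co ac gf.
suff -> : induced L A = induced (link K v) [set a in vertices K | h a < h v]%SET by [].
(* Lower vertices not adjacent to [v] are not in its link. *)
rewrite -(eq_induced (A := A)); last first.
- move=> x; rewrite link_vertex// => /andP[_ vxK]; rewrite !finset.inE vxK andbT.
  by [].
- by apply: link_complex; rewrite // -in_vertices.
by apply/setP=> s; rewrite !in_induced -andbA andbb.
Qed.

End DescendingLink.

(** * From a convex realization to the sweep *)

Lemma convex_set_segment (R : realType) (T : finType) (k : nat)
    (K : {set {set T}}) (f : T -> 'rV[R]_k) :
  convex_set (realization K f) -> segment_convex (body K f).
Proof.
have bodyE x : body K f x <-> realization K f x.
  split=> [[w [w0 w1 wK] ->]|[w [w0 w1 wK] <-]]; last by exists w.
  exists (finfun w); last by apply: eq_bigr => a _; rewrite ffunE.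
  split=> [a||]; rewrite ?ffunE//.
    by rewrite -w1; apply: eq_bigr => a _; rewrite ffunE.
  by rewrite -[X in X \in K](_ : [set a | w a != 0]%SET = _)//; apply/setP=> a; rewrite !finset.inE ffunE.
move=> cX x y t /bodyE Xx /bodyE Xy /andP[t0 t1]; apply/bodyE.
(* The convex combination behind [convex_set] gives weight [t] to its first point, hence the
   exchange of [x] and [y]. *)
have := cX y x (interval_inference.Itv01 t0 t1) (mem_set Xy) (mem_set Xx) => /set_mem.
by rewrite /segment_point addrC.
Qed.

Theorem theorem2 (R : realType) (T : finType) (K : {set {set T}}) :
  simplicial_complex K -> complex_dim K = 3 -> convex_complex R K -> nonevasive K.
Proof.
move=> Kc Kdim [k [f [/linear_embeddingW inj /convex_set_segment Xconv]]].
have K4 : \max_(s in K) #|s| = 4%N.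
  by move: Kdim => /eqP; rewrite /complex_dim subr_eq => /eqP[].
have Kle s : s \in K -> (#|s| <= 4)%N.
  by move=> sK; rewrite -K4; exact: (@leq_bigmax_cond _ _ (fun s : {set T} => #|s|)).
have [s sK s4] : exists2 s, s \in K & #|s| = 4%N.
  have K0 : (0 < #|K|)%N by case: Kc => K0 _; apply/card_gt0P; exists finset.set0.
  by have [s sK sE] := eq_bigmax_cond (fun s : {set T} => #|s|) K0; exists s; rewrite // -sE.
have /choice[bary baryP] : forall x, exists w : T -> R, body K f x ->
    weight K w /\ x = \sum_a w a *: f a.
  move=> x; have [[w wK xE]|nX] := pselect (body K f x); first by exists w.
  by exists (fun _ => 0).
(* The ambient dimension [k] is arbitrary, but by convexity the vertices span an affine space of
   dimension at most 3. *)
have d3 := dim_le_vertices Kc inj baryP Xconv sK s4 Kle.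
have [u uP] := generic_functional f.
have Kv : induced K (vertices K) = K.
  apply/setP=> t; rewrite in_induced; have [tK|//] := boolP (t \in K).
  apply/fintype.subsetP => a at'; rewrite in_vertices; case: Kc => _ Ks.
  by apply: Ks tK _; rewrite finset.sub1set.
rewrite -Kv; apply: (nonevasive_sweep (e := fun a => functional u (f a))) => //.
- by move=> a; rewrite in_vertices.
- move=> a b; rewrite !in_vertices => aK bK /eqP fab; apply: (embedding_inj inj) => //.
  by apply/eqP; apply: contraTT fab; exact: uP.
- have [a aS] : exists a, a \in s by apply/finset.set0Pn; rewrite -finset.card_gt0 s4.
  by apply/finset.set0Pn; exists a; rewrite -Kv in sK; move: sK; rewrite in_induced => /andP[_ /fintype.subsetP]; apply.
- by move=> v y vK yK yv; exact: (nonevasive_descending_link Kc inj baryP Xconv vK d3 yK yv).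
Qed.
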